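(* Let $(M,\{\omega_1,\dots,\omega_k\})$ be a $k$-pre-symplectic manifold. There always exist a $k$-symplectic manifold $(\widetilde M,\{\widetilde\omega_1,\dots,\widetilde\omega_k\})$ and an embedding $\mathfrak i\colon M\hookrightarrow\widetilde M$ with $\mathfrak i^*\widetilde\omega_j=\omega_j$ for $j=1,\dots,k$ such that $\mathfrak i(M)$ is a $k$-coisotropic submanifold of $\widetilde M$.
   Context: All manifolds, forms and maps are smooth. A $k$-pre-symplectic manifold is a pair $(M,\{\omega_1,\dots,\omega_k\})$ with $M$ a finite-dimensional manifold and $\omega_j\in\Omega^2(M)$ closed. Standing assumptions on such a manifold $M$: each $\omega_j$ has constant rank, and the characteristic distribution $\mathcal V=\bigcap_{j=1}^k\ker\omega_j$ has constant rank. A $k$-symplectic manifold is a manifold with $k$ closed 2-forms $\widetilde\omega_1,\dots,\widetilde\omega_k$ such that $\bigcap_{j=1}^k\ker\widetilde\omega_j=\{0\}$ at every point. (No further local-model requirement is imposed.) A submanifold $N$ of a $k$-symplectic manifold $(\widetilde M,\{\widetilde\omega_j\})$ is $\ell$-coisotropic ($1\le\ell\le k$) if for every $n\in N$ the subspace $\{X\in T_n\widetilde M:\widetilde\omega_1(X,Y)=\dots=\widetilde\omega_\ell(X,Y)=0\ \forall Y\in T_nN\}$ is contained in $T_nN$. *)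

(* Defs.v *)
From mathcomp Require Import all_boot all_order all_algebra.
From mathcomp Require Import boolp classical_sets functions cardinality reals.
From mathcomp Require Import topology normedtype derive.

Set Implicit Arguments.
Unset Strict Implicit.
Unset Printing Implicit Defensive.

Import Order.TTheory GRing.Theory Num.Theory.
Import numFieldNormedType.Exports.

Local Open Scope classical_set_scope.
Local Open Scope ring_scope.

(* Meant for an open set U: only the germs of f at points of U matter. *)
Fixpoint Ck_on (R : realType) (V W : normedModType R) (r : nat) (U : set V)
    (f : V -> W) : Prop :=
  if r is s.+1 then
    (forall x, U x -> differentiable f x) /\
    (forall v, Ck_on s U (fun x => 'D_v f x))
  else forall x, U x -> {for x, continuous f}.

Definition smooth_on (R : realType) (V W : normedModType R) (U : set V)
    (f : V -> W) : Prop :=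
  forall r, Ck_on r U f.

(* [chart_map] and [chart_inv] are total functions whose values outside
   [chart_dom], resp. [chart_cod], are irrelevant. *)
Record chart (R : realType) (T : topologicalType) (n : nat) := Chart {
  chart_dom : set T;
  chart_cod : set 'rV[R]_n;
  chart_map : T -> 'rV[R]_n;
  chart_inv : 'rV[R]_n -> T;
  chart_dom_open : open chart_dom;
  chart_cod_open : open chart_cod;
  chart_mapS : forall p, chart_dom p -> chart_cod (chart_map p);
  chart_invS : forall x, chart_cod x -> chart_dom (chart_inv x);
  chart_mapK : forall p, chart_dom p -> chart_inv (chart_map p) = p;
  chart_invK : forall x, chart_cod x -> chart_map (chart_inv x) = x;
  chart_map_cont : forall p, chart_dom p -> {for p, continuous chart_map};
  chart_inv_cont : forall x, chart_cod x -> {for x, continuous chart_inv}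
}.

(* The atlas need not be maximal. [chart_at] fixes, at every point, a chart of
   the atlas around it; it only serves to coordinatize the tangent spaces. *)
Record manifold (R : realType) := Manifold {
  carrier :> topologicalType;
  dim : nat;
  atlas : set (chart R carrier dim);
  chart_at : carrier -> chart R carrier dim;
  hausdorff_carrier : hausdorff_space carrier;
  second_countable_carrier : @second_countable carrier;
  chart_at_atlas : forall p, atlas (chart_at p);
  chart_at_dom : forall p, chart_dom (chart_at p) p;
  atlas_compat : forall c d, atlas c -> atlas d ->
    smooth_on (chart_cod c `&` chart_inv c @^-1` chart_dom d)
              (chart_map d \o chart_inv c)
}.

Arguments dim {R} M : rename.
Arguments atlas {R} M : rename.
Arguments chart_at {R M} p : rename.

(* T_p M, every tangent vector being represented by its coordinates in the
   preferred chart [chart_at p]. *)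
Definition tangent (R : realType) (M : manifold R) (p : M) : vectType R :=
  'rV[R]_(dim M).

Definition smooth_map (R : realType) (M N : manifold R) (f : M -> N) : Prop :=
  continuous f /\
  forall c d, atlas M c -> atlas N d ->
    smooth_on (chart_cod c `&` (f \o chart_inv c) @^-1` chart_dom d)
              (chart_map d \o f \o chart_inv c).

Definition differential (R : realType) (M N : manifold R) (f : M -> N) (p : M)
    (u : tangent p) : tangent (f p) :=
  'd (chart_map (chart_at (f p)) \o f \o chart_inv (chart_at p))
     (chart_map (chart_at p) p) u.

Definition embedding (R : realType) (M N : manifold R) (f : M -> N) : Prop :=
  [/\ smooth_map f,
      forall p, injective (@differential R M N f p),
      injective f &
      forall U : set M, open U -> exists2 V : set N, open V & U = f @^-1` V].

(* The bilinear form with Gram matrix A. *)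
Definition form (R : realType) (n : nat) (A : 'M[R]_n) (u v : 'rV[R]_n) : R :=
  (u *m A *m v^T) 0 0.

(* Gram matrix, in the coordinates of the chart c and at the point with
   coordinates x, of the field of bilinear forms w. As 'J f x acts on row
   vectors on the right, this is w (D h u) (D h v) for the change of
   coordinates h from c to the preferred chart. *)
Definition local_form (R : realType) (M : manifold R)
    (w : M -> 'M[R]_(dim M)) (c : chart R M (dim M)) (x : 'rV[R]_(dim M)) :
    'M[R]_(dim M) :=
  let p := chart_inv c x in
  let J := 'J (chart_map (chart_at p) \o chart_inv c) x in
  J *m w p *m J^T.

(* [gram p] is the Gram matrix of the form on [tangent p]. *)
Record two_form (R : realType) (M : manifold R) := TwoForm {
  gram :> M -> 'M[R]_(dim M);
  gram_alt : forall p, (gram p)^T = - gram p;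
  gram_smooth : forall c, atlas M c -> smooth_on (chart_cod c) (local_form gram c)
}.

Definition form_at (R : realType) (M : manifold R) (w : two_form M) (p : M)
    (u v : tangent p) : R :=
  form (w p) u v.

(* Exterior derivative on R^n, on constant vector fields. *)
Definition ext_deriv (R : realType) (n : nat) (g : 'rV[R]_n -> 'M[R]_n)
    (x u v w : 'rV[R]_n) : R :=
  form ('D_u g x) v w - form ('D_v g x) u w + form ('D_w g x) u v.

Definition closed_form (R : realType) (M : manifold R) (w : two_form M) : Prop :=
  forall c, atlas M c -> forall x, chart_cod c x ->
  forall u1 u2 u3, ext_deriv (local_form w c) x u1 u2 u3 = 0.

(* The row space of [char_dist w p] is the intersection of the kernels
   [{u | w j (u, v) = 0 for all v}] in [tangent p]. *)
Definition char_dist (R : realType) (M : manifold R) (k : nat)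
    (w : 'I_k -> two_form M) (p : M) : 'M[R]_(dim M) :=
  (\bigcap_(j < k) kermx (w j p))%MS.

Definition constant_rank (R : realType) (M : manifold R)
    (A : M -> 'M[R]_(dim M)) : Prop :=
  exists r, forall p, \rank (A p) = r.

Definition presymplectic (R : realType) (M : manifold R) (k : nat)
    (w : 'I_k -> two_form M) : Prop :=
  [/\ forall j, closed_form (w j),
      forall j, constant_rank (w j) &
      constant_rank (char_dist w)].

Definition symplectic (R : realType) (M : manifold R) (k : nat)
    (w : 'I_k -> two_form M) : Prop :=
  (forall j, closed_form (w j)) /\ (forall p, char_dist w p = 0).

(* For an embedding f: the submanifold is f(M), and its tangent space at f p is
   the range of the differential of f at p. *)
Definition coisotropic (R : realType) (M N : manifold R) (k l : nat)
    (w : 'I_k -> two_form N) (f : M -> N) : Prop :=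
  forall (p : M) (X : tangent (f p)),
    (forall j : 'I_k, (j < l)%N ->
       forall Y : tangent p, form_at (w j) X (differential f Y) = 0) ->
    exists Y : tangent p, X = differential f Y.

(* Main.v *)
Require Import Defs.
From HB Require Import structures.
From mathcomp Require Import all_boot all_order all_algebra.
From mathcomp Require Import boolp classical_sets functions cardinality reals.
From mathcomp Require Import topology normedtype landau derive realfun sequences exp.
From mathcomp Require Import ring lra.
Import Defs.

(** Let V be the characteristic distribution of M, V' its dual bundle, pi the
projection V' -> M, and N the part of the total space of V' where the forms
(pullback of omega_j by pi) + d theta have no common kernel; M is embedded as
the zero section.  Here theta at (p, eta) is the covector eta o Q o d pi, where
Q : TM -> V is a smooth bundle map restricting to a positive multiple of the
identity on V.  Along the zero section the tangent space of V' is TM + V' and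
d theta pairs V' with TM through Q; since Q is onto V and V is the common kernel
of the omega_j, the forms have no common kernel there, and a vector orthogonal
to TM for one of them has no V'-component.

Near q, V is the kernel of [A = sum_j omega_j omega_j^T], of constant rank.  If the
rows of K are a basis of ker A(x_q) and [K L = 1], then [A(x_q) + L K] is invertible
because A is symmetric, and [K (A(x) + L K)^-1] is a frame of V at x, dual to the
constant matrix L.  The matrix L gives a constant local Q; these are glued with
a locally finite family of smooth weights psi_i with positive sum s, which
exists because M is Hausdorff and second countable.  The weights are not
normalized: only s > 0 matters. *)

Set Implicit Arguments.
Unset Strict Implicit.
Unset Printing Implicit Defensive.

Import Order.TTheory GRing.Theory Num.Theory.
Import numFieldNormedType.Exports.

Local Open Scope classical_set_scope.
Local Open Scope ring_scope.

(** * Differential calculus of C^k functions *)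

Section Differentiability.
Context {R : realType}.

(** The form theta is the canonical one-form of T*M pulled back along the bundle map V' -> T*M, eta
    |-> eta o Q. Its local expressions therefore match under every change of chart and frame, and d
    theta is closed whatever Q is. This is the classical coisotropic embedding of one presymplectic
    form, with the same d theta added to every omega_j: a direction of TM outside V is already seen
    by some omega_j, so theta only has to pair V with V'. The obstacle is that projections onto V
    are only available locally. The bundle maps TM -> V that restrict on V to a positive multiple of
    the identity form a convex cone, so a weighted sum of local projections stays among them. Away
    from the zero section d theta involves derivatives of Q, but always multiplied by eta; on M they
    disappear, and nondegeneracy there is linear algebra. Taking N to be the whole nondegenerate
    locus makes its openness the continuity of a determinant. Since V' is not given as a manifold,
    it is glued from the frame charts. *)

Lemma near_eq_differentiable (V W : normedModType R) (f g : V -> W) (x : V) :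
  (\near x, f x = g x) -> differentiable f x -> differentiable g x.
Proof.
move=> fg df; have fgx := nbhs_singleton fg.
have fg0 : \forall y \near (0 : V), f (y + x) = g (y + x).
  have := fg; rewrite (near_shift 0) /=.
  by apply: filterS => y /=; rewrite subr0 addrC.
have E : g \o shift x = cst (g x) + 'd f x +o_ 0 id.
  apply/eqaddoP => e e0; have := diff_locally df.
  move=> /eqaddoP/(_ _ e0) H; near=> y.
  have -> : (g \o shift x - (cst (g x) + 'd f x)) y =
            (f \o shift x - (cst (f x) + 'd f x)) y.
    rewrite /= !fctE /= fgx; congr (_ - _).
    by apply/esym; near: y; exact: fg0.
  by near: y.
apply/diff_locallyP.
have -> : 'd g x = 'd f x :> (V -> W) by apply: diff_unique => //; exact: diff_continuous.
by split => //; exact: diff_continuous.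
Unshelve. all: by end_near.
Qed.

Lemma Ck_onW (V W : normedModType R) r (U O : set V) (f : V -> W) :
  O `<=` U -> Ck_on r U f -> Ck_on r O f.
Proof.
move=> OU; elim: r f => [|r IH] f /=; first by move=> H x /OU /H.
by move=> [H1 H2]; split => [x /OU /H1|v] //; apply: IH.
Qed.

Lemma eq_Ck_on (V W : normedModType R) r (U : set V) (f g : V -> W) :
  open U -> (forall x, U x -> f x = g x) -> Ck_on r U f -> Ck_on r U g.
Proof.
move=> oU; elim: r f g => [|r IH] f g fg.
  move=> H x Ux; suff : g @ x --> g x by []; rewrite -(fg x Ux).
  apply: cvg_trans (H x Ux); apply: near_eq_cvg.
  by near do apply: fg; exact: open_nbhs_nbhs.
have nfg x : U x -> \near x, f x = g x.
  by move=> Ux; near do apply: fg; exact: open_nbhs_nbhs.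
move=> [H1 H2]; split.
  by move=> x Ux; apply: near_eq_differentiable (H1 x Ux); apply: nfg.
move=> v; apply: IH (H2 v) => x Ux.
by apply: near_eq_derive; apply: nfg.
Unshelve. all: by end_near.
Qed.

Lemma Ck_on_local (V W : normedModType R) r (U : set V) (f : V -> W) :
  (forall x, U x -> exists O, [/\ open O, O x & Ck_on r O f]) -> Ck_on r U f.
Proof.
elim: r f => [|r IH] f H.
  by move=> x /H[B [_ Bx]] /(_ x Bx).
split => [x /H[B [_ Bx [H1 _]]]|v]; first exact: H1.
by apply: IH => x /H[B [oB Bx [_ H2]]]; exists B; split => //; exact: H2.
Qed.

Lemma Ck_on_pred (V W : normedModType R) r (U : set V) (f : V -> W) :
  Ck_on r.+1 U f -> Ck_on r U f.
Proof.
elim: r f => [|r IH] f [H1 H2].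
  by move=> x /H1 /differentiable_continuous.
by split => // v; apply: IH.
Qed.

Lemma Ck_on_cst (V W : normedModType R) r (U : set V) (c : W) :
  Ck_on r U (fun _ : V => c).
Proof.
elim: r c => [|r IH] c; first by move=> x _; exact: cvg_cst.
split=> [x _|v]; first exact: differentiable_cst.
by have -> : (fun x => 'D_v (fun _ : V => c) x) = fun=> 0
  by apply/funext => x; rewrite derive_cst.
Qed.

Lemma Ck_on_linear (V W : normedModType R) r (U : set V) (f : {linear V -> W}) :
  continuous f -> Ck_on r U f.
Proof.
move=> cf; case: r => [x _|r]; first exact: cf.
split=> [x _|v]; first exact: linear_differentiable.
have -> : (fun x => 'D_v f x) = fun=> f v.
  by apply/funext => x; rewrite deriveE ?diff_lin //; exact: linear_differentiable.
exact: Ck_on_cst.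
Qed.

Lemma Ck_on_add (V W : normedModType R) r (U : set V) (f g : V -> W) :
  open U -> Ck_on r U f -> Ck_on r U g -> Ck_on r U (fun x => f x + g x).
Proof.
move=> oU; elim: r f g => [|r IH] f g /=.
  by move=> cf cg x Ux; apply: cvgD; [exact: cf|exact: cg].
move=> [f1 f2] [g1 g2]; split => [x Ux|v].
  by apply: differentiableD; [exact: f1|exact: g1].
apply: (eq_Ck_on oU _ (IH _ _ (f2 v) (g2 v))) => x Ux.
by apply/esym/deriveD; apply: diff_derivable; [exact: f1|exact: g1].
Qed.

Lemma Ck_on_opp (V W : normedModType R) r (U : set V) (f : V -> W) :
  open U -> Ck_on r U f -> Ck_on r U (fun x => - f x).
Proof.
move=> oU; elim: r f => [|r IH] f /=.
  by move=> cf x Ux; apply: cvgN; exact: cf.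
move=> [f1 f2]; split => [x Ux|v]; first by apply: differentiableN; exact: f1.
apply: (eq_Ck_on oU _ (IH _ (f2 v))) => x Ux.
by apply/esym/deriveN; apply: diff_derivable; exact: f1.
Qed.

Lemma Ck_on_mul (V : normedModType R) r (U : set V) (f g : V -> R) :
  open U -> Ck_on r U f -> Ck_on r U g -> Ck_on r U (fun x => f x * g x).
Proof.
move=> oU; elim: r f g => [|r IH] f g.
  by move=> cf cg x Ux; apply: cvgM; [exact: cf|exact: cg].
move=> fr gr; have [[f1 f2] [g1 g2]] := (fr, gr); split => [x Ux|v].
  by apply: differentiableM; [exact: f1|exact: g1].
apply: (eq_Ck_on oU _ (Ck_on_add oU (IH _ _ (Ck_on_pred fr) (g2 v))
  (IH _ _ (Ck_on_pred gr) (f2 v)))) => x Ux.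
by apply/esym/deriveM; apply: diff_derivable; [exact: f1|exact: g1].
Qed.

Lemma Ck_on_inv (V : normedModType R) r (U : set V) (f : V -> R) :
  open U -> (forall x, U x -> f x != 0) -> Ck_on r U f ->
  Ck_on r U (fun x => (f x)^-1).
Proof.
move=> oU f0; elim: r => [|r IH].
  by move=> cf x Ux; apply: cvgV; [exact: f0|exact: cf].
move=> fr; have [f1 f2] := fr; split => [x Ux|v].
  by apply: differentiableV; [exact: f1|exact: f0].
have ir := IH (Ck_on_pred fr).
apply: (eq_Ck_on oU _ (Ck_on_opp oU (Ck_on_mul oU (Ck_on_mul oU ir ir) (f2 v)))).
move=> x Ux; rewrite deriveV; [|exact: f0|exact/diff_derivable/f1].
by rewrite expr2 invfM -mulNr.
Qed.

Lemma Ck_on_sum (V W : normedModType R) r (U : set V) (I : Type) (s : seq I)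
    (P : pred I) (f : I -> V -> W) :
  open U -> (forall i, P i -> Ck_on r U (f i)) ->
  Ck_on r U (fun x => \sum_(i <- s | P i) f i x).
Proof.
move=> oU H; elim: s => [|i s IH].
  by under eq_fun do rewrite big_nil; exact: Ck_on_cst.
under eq_fun do rewrite big_cons.
by case Pi : (P i) => //; apply: Ck_on_add => //; exact: H.
Qed.

Lemma Ck_on_prod (V : normedModType R) r (U : set V) (I : Type) (s : seq I)
    (P : pred I) (f : I -> V -> R) :
  open U -> (forall i, P i -> Ck_on r U (f i)) ->
  Ck_on r U (fun x => \prod_(i <- s | P i) f i x).
Proof.
move=> oU H; elim: s => [|i s IH].
  by under eq_fun do rewrite big_nil; exact: Ck_on_cst.
under eq_fun do rewrite big_cons.
by case Pi : (P i) => //; apply: Ck_on_mul => //; exact: H.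
Qed.

Lemma Ck_on_scale_vec (V W : normedModType R) r (U : set V) (f : V -> R) (w : W) :
  open U -> Ck_on r U f -> Ck_on r U (fun x => f x *: w).
Proof.
move=> oU; elim: r f => [|r IH] f.
  by move=> cf x Ux; apply: cvgZl; exact: cf.
move=> [f1 f2]; split=> [x Ux|v]; first exact/differentiableZl/f1.
apply: (eq_Ck_on oU _ (IH _ (f2 v))) => x Ux; have dfx := f1 x Ux.
by rewrite !deriveE ?diffZl //; exact: differentiableZl.
Qed.

Lemma Ck_on_coord (V : normedModType R) m n r (U : set V) (f : V -> 'M[R]_(m, n))
    i j :
  open U -> Ck_on r U f -> Ck_on r U (fun x => f x i j).
Proof.
move=> oU; elim: r f => [|r IH] f.
  move=> cf x Ux; apply: (@continuous_comp _ _ _ f (fun A : 'M[R]_(m, n) => A i j)).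
    exact: cf.
  exact: coord_continuous.
move=> [f1 f2]; split=> [x Ux|v].
  by apply: (@differentiable_comp _ _ _ _ f (fun A : 'M[R]_(m, n) => A i j));
    [exact: f1|exact: differentiable_coord].
apply: (eq_Ck_on oU _ (IH _ (f2 v))) => x Ux.
by rewrite derive_mx ?mxE //; exact/diff_derivable/f1.
Qed.

Lemma Ck_on_mx (V : normedModType R) m n r (U : set V) (f : V -> 'M[R]_(m, n)) :
  open U -> (forall i j, Ck_on r U (fun x => f x i j)) -> Ck_on r U f.
Proof.
move=> oU H; have -> : f = (fun x => \sum_i \sum_j f x i j *: delta_mx i j).
  by apply/funext => x; exact: matrix_sum_delta.
apply: Ck_on_sum => // i _; apply: Ck_on_sum => // j _.
exact: Ck_on_scale_vec.
Qed.

(** [Ck_on] differentiates in fixed directions only, so the derivative of g along the moving vector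
    ['D_v h x] is expanded in the standard basis; this is why the middle space consists of row
    vectors. The induction varies g, as the partial derivatives of g are again composed with h. *)
Lemma Ck_on_comp_scalar m (V : normedModType R) r (U : set V) (O : set 'rV[R]_m)
    (h : V -> 'rV[R]_m) (g : 'rV[R]_m -> R) :
  open U -> open O -> (forall x, U x -> O (h x)) ->
  Ck_on r U h -> Ck_on r O g -> Ck_on r U (fun x => g (h x)).
Proof.
move=> oU oO UO; elim: r g => [|r IH] g.
  move=> ch cg x Ux; apply: continuous_comp; [exact: ch|exact/cg/UO].
move=> hr gr; have [[h1 h2] [g1 g2]] := (hr, gr); split=> [x Ux|v].
  by apply: differentiable_comp; [exact: h1|exact/g1/UO].
have : Ck_on r U (fun x => \sum_i ('D_v h x) 0 i * 'D_(delta_mx 0 i) g (h x)).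
  apply: Ck_on_sum => // i _; apply: Ck_on_mul => //; first exact: (Ck_on_coord 0 i oU (h2 v)).
  by apply: (IH (fun y => 'D_(delta_mx 0 i) g y)); [exact: Ck_on_pred|exact: g2].
apply: eq_Ck_on => // x Ux.
have dh := h1 x Ux; have dg := g1 _ (UO x Ux).
rewrite [RHS]deriveE; last exact: differentiable_comp.
rewrite (diff_comp dh dg) /= -(deriveE v dh).
rewrite [in RHS](row_sum_delta ('D_v h x)) linear_sum; apply: eq_bigr => i _.
by rewrite linearZ /= -(deriveE _ dg).
Qed.

Lemma Ck_on_comp m p q (V : normedModType R) r (U : set V) (O : set 'rV[R]_m)
    (h : V -> 'rV[R]_m) (g : 'rV[R]_m -> 'M[R]_(p, q)) :
  open U -> open O -> (forall x, U x -> O (h x)) ->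
  Ck_on r U h -> Ck_on r O g -> Ck_on r U (fun x => g (h x)).
Proof.
move=> oU oO UO hr gr; apply: Ck_on_mx => // i j.
by apply: (Ck_on_comp_scalar (g := fun x => g x i j) oU oO UO hr); exact: Ck_on_coord.
Qed.

End Differentiability.

(** * Symmetry of second derivatives *)

Section Schwarz.
Context {R : realType} {V : normedModType R}.

Lemma is_derive_line (g : V -> R) (y u : V) (s : R) :
  differentiable g (y + s *: u) ->
  is_derive s 1 (fun t : R => g (y + t *: u)) ('D_u g (y + s *: u)).
Proof.
move=> dg; pose l := fun t : R => y + t *: u.
have dl : is_diff s l (0 + ( *:%R ^~ u)).
  exact: (is_diffD (is_diff_cst y s) (is_diff_scalel s u)).
have dlx : differentiable l s by [].
have dgl : differentiable g (l s) by [].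
have dc : differentiable (g \o l) s by exact: differentiable_comp.
apply: DeriveDef; first exact: diff_derivable.
rewrite (@deriveE _ _ _ (g \o l)) // diff_comp //= [X in _ (X 1)](diff_val).
by rewrite !fctE add0r scale1r -deriveE.
Qed.

Lemma MVT_line (g : V -> R) (y w : V) (h : R) : 0 <= h ->
  (forall s, 0 <= s <= h -> differentiable g (y + s *: w)) ->
  exists2 s, 0 <= s <= h & g (y + h *: w) - g y = 'D_w g (y + s *: w) * h.
Proof.
move=> h0 dg.
have dl s : 0 <= s <= h -> is_derive s 1 (fun t : R => g (y + t *: w)) ('D_w g (y + s *: w)).
  by move=> /dg; exact: is_derive_line.
have [||s] := @MVT_segment R (fun t => g (y + t *: w)) (fun t => 'D_w g (y + t *: w)) 0 h h0.
- by move=> s; rewrite in_itv /= => /andP[s0 sh]; apply: dl; rewrite !ltW.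
- apply: continuous_in_subspaceT => s; rewrite inE /= in_itv /= => /dl ds.
  by apply: differentiable_continuous; apply/derivable1_diffP.
rewrite in_itv /= => sh E; exists s => //.
by move: E; rewrite scale0r addr0 subr0.
Qed.

(** The mean value theorem, along u for the increment y |-> f (y + h v) - f y and then along v for
    ['D_u f], writes the second difference as h^2 times the mixed derivative at some point of the
    parallelogram; continuity compares that value with the one at x. *)
Lemma mixed_difference (f : V -> R) (U : set V) (x u v : V) (e : R) :
  open U -> smooth_on U f -> U x -> 0 < e ->
  exists2 d, 0 < d & forall h, 0 < h -> h < d ->
   `|f (x + h *: u + h *: v) - f (x + h *: u) - f (x + h *: v) + f x
     - h ^+ 2 * 'D_v (fun y => 'D_u f y) x| <= h ^+ 2 * e.
Proof.
move=> oU sf Ux e0.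
have [f1 /(_ u) fu2] := sf 2%N; have [fu1 /(_ v) fuv] := fu2.
have /cvgrPdist_lt/(_ e e0) cx := fuv x Ux.
have nU : \forall y \near x, U y by exact: open_nbhs_nbhs.
have nn : nbhs x (U `&` (fun t => `|'D_v ('D_u f) x - 'D_v ('D_u f) t| < e)) by exact: filterI.
  have /nbhs_ballP[r /= r0 Hr] := nn.
(* For h K < r the parallelogram with sides h u and h v stays in the ball of radius r; the summand 1
   keeps K positive when u = v = 0. *)
set K := `|u| + `|v| + 1.
have K0 : 0 < K by rewrite /K ltr_pwDr // addr_ge0.
exists (r / K); first by rewrite divr_gt0.
move=> h h0; rewrite ltr_pdivlMr // => hr.
have inb s t : 0 <= s <= h -> 0 <= t <= h -> ball x r (x + s *: u + t *: v).
  move=> /andP[s0 sh] /andP[t0 th].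
  rewrite -ball_normE /= opprD addrA opprD addrA subrr sub0r -opprD normrN.
  apply: le_lt_trans hr; apply: le_trans (ler_normD _ _) _.
  rewrite !normrZ !ger0_norm // /K !mulrDr mulr1.
  have := ler_wpM2r (normr_ge0 u) sh; have := ler_wpM2r (normr_ge0 v) th.
  by lra.
have inU s t : 0 <= s <= h -> 0 <= t <= h -> U (x + s *: u + t *: v).
  by move=> sh th; have /Hr[] := inb s t sh th.
have h00 : (0 : R) <= (0 : R) <= h by rewrite lexx ltW.
have hhh : 0 <= h <= h by rewrite lexx ltW.
have [||s sh E1] := @MVT_line (fun y => f (y + h *: v) - f y) x u h.
- exact: ltW.
- move=> s sh; apply: differentiableB; last first.
    by apply: f1; rewrite -[_ + _]addr0 -(scale0r v); exact: inU.
  apply: (@differentiable_comp _ _ _ _ (fun y => y + h *: v) f) => //.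
  by apply: f1; exact: inU.
have dfs : differentiable f (x + s *: u).
  by apply: f1; rewrite -[_ + _]addr0 -(scale0r v); exact: inU.
have dfsv : differentiable (fun y => f (y + h *: v)) (x + s *: u).
  apply: (@differentiable_comp _ _ _ _ (fun y => y + h *: v) f) => //.
  by apply: f1; exact: inU.
have [||t th E2] := @MVT_line (fun y => 'D_u f y) (x + s *: u) v h.
- exact: ltW.
- by move=> t th; apply: fu1; exact: inU.
have E3 : 'D_u (fun y => f (y + h *: v) - f y) (x + s *: u) =
   'D_v (fun y => 'D_u f y) (x + s *: u + t *: v) * h.
  have EB : 'D_u (fun y => f (y + h *: v) - f y) (x + s *: u) =
      'D_u (fun y => f (y + h *: v)) (x + s *: u) - 'D_u f (x + s *: u).
    by apply: deriveB; exact: diff_derivable.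
  rewrite -E2; apply: etrans EB _.
  congr (_ - _); rewrite /derive; set d := (fun _ : R => _); set d' := (fun _ : R => _).
  by suff -> : d = d' by []; rewrite funeqE => z; rewrite /d /d' /= -!addrA.
have /Hr[_ /=] := inb s t sh th.
move: E1; rewrite E3.
generalize ('D_v (fun y => 'D_u f y) x) => D.
generalize ('D_v (fun y => 'D_u f y) (x + s *: u + t *: v)) => D' E1 HD.
have E4 : f (x + h *: u + h *: v) - f (x + h *: u) - f (x + h *: v) + f x = D' * h * h.
  by rewrite -E1 opprD opprK addrA.
rewrite E4; have -> : D' * h * h - h ^+ 2 * D = h ^+ 2 * (D' - D) by ring.
by rewrite normrM ger0_norm ?sqr_ge0 // ler_wpM2l ?sqr_ge0 // distrC ltW.
Qed.

(** The second difference is symmetric in u and v, so after division by h^2 both mixed derivatives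
    lie within e / 2 of the same number. *)
Lemma derive_comm (f : V -> R) (U : set V) (x u v : V) :
  open U -> smooth_on U f -> U x ->
  'D_u (fun y => 'D_v f y) x = 'D_v (fun y => 'D_u f y) x.
Proof.
move=> oU sf Ux; apply/eqP; rewrite -subr_eq0 -normr_le0; apply/ler_addgt0Pl => e e0.
have e2 : 0 < e / 2 by rewrite divr_gt0.
have [d1 d10 H1] := @mixed_difference f U x u v _ oU sf Ux e2.
have [d2 d20 H2] := @mixed_difference f U x v u _ oU sf Ux e2.
pose h := Num.min d1 d2 / 2.
have m0 : 0 < Num.min d1 d2 by rewrite lt_min d10.
have h0 : 0 < h by rewrite divr_gt0.
have hm : h < Num.min d1 d2 by rewrite ltr_pdivrMr // mulr_natr mulr2n ltrDl.
move: hm; rewrite lt_min => /andP[/(H1 h h0) {}H1 /(H2 h h0)].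
rewrite [x + h *: v + h *: u]addrAC => {}H2.
rewrite addr0; move: H1 H2; set a := f _; set b := f _; set c := f _.
generalize ('D_u (fun y => 'D_v f y) x) ('D_v (fun y => 'D_u f y) x) => A B H1 H2.
have hh : 0 < h ^+ 2 by rewrite exprn_gt0.
rewrite -(ler_pM2l hh) -{1}(gtr0_norm hh) -normrM.
have -> : h ^+ 2 * (A - B) =
    (a - b - c + f x - h ^+ 2 * B) - (a - c - b + f x - h ^+ 2 * A) by ring.
apply: le_trans (ler_normB _ _) _.
have -> : h ^+ 2 * e = h ^+ 2 * (e / 2) + h ^+ 2 * (e / 2) by field.
exact: lerD.
Qed.
End Schwarz.

(** * The flat function exp(-1/t) *)

Section Flat.
Context {R : realType}.

(** [flat 0] is the usual exp(-1/t), extended by 0. The powers of 1/t are included so that the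
    derivative of a member is a linear combination of members. *)
Definition flat (m : nat) (t : R) : R :=
  if 0 < t then t^-1 ^+ m * expR (- t^-1) else 0.

Lemma flat_gt0 m t : 0 < t -> 0 < flat m t.
Proof. by move=> t0; rewrite /flat t0 mulr_gt0 ?expR_gt0 // exprn_gt0 // invr_gt0. Qed.

Lemma flat_le0 m t : t <= 0 -> flat m t = 0.
Proof. by move=> t0; rewrite /flat ltNge t0. Qed.

Lemma flat_ge0 m t : 0 <= flat m t.
Proof. by case: (ltP 0 t) => [/(flat_gt0 m)/ltW|/(flat_le0 m)->]. Qed.

(** One term of the exponential series, exp(1/t) >= (1/t)^(m+1) / (m+1)!, already gives a bound
    linear in t, enough for the limit at 0. *)
Lemma flat_bound m t : flat m t <= (m.+1)`!%:R * `|t|.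
Proof.
case: (ltP 0 t) => t0; last by rewrite flat_le0 // mulr_ge0.
rewrite /flat t0 gtr0_norm // expRN ler_pdivrMr ?expR_gt0 //.
have i0 : 0 <= t^-1 by rewrite invr_ge0 ltW.
have H := expR_ge1Dxn m i0.
have F0 : 0 < (m.+1)`!%:R :> R by rewrite ltr0n fact_gt0.
have {}H : t^-1 ^+ m.+1 <= (m.+1)`!%:R * expR t^-1.
  by rewrite mulrC -ler_pdivrMr //; apply: le_trans H; rewrite lerDr.
rewrite mulrAC -ler_pdivrMr //.
by rewrite -exprSr.
Qed.

Lemma flat_cvg0 m : flat m h @[h --> 0^'] --> (0 : R).
Proof.
apply/cvgrPdist_lt => e e0.
have F0 : 0 < (m.+1)`!%:R :> R by rewrite ltr0n fact_gt0.
near=> h; rewrite sub0r normrN ger0_norm ?flat_ge0 //.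
apply: le_lt_trans (flat_bound _ _) _.
rewrite mulrC -ltr_pdivlMr //; near: h.
by apply: dnbhs0_lt; rewrite divr_gt0.
Unshelve. all: by end_near.
Qed.

Lemma is_derive_flat m (t : R) :
  is_derive t 1 (flat m) (flat m.+2 t - m%:R * flat m.+1 t).
Proof.
case: (ltgtP t 0) => [t0|t0|->].
- rewrite !flat_le0 ?ltW // mulr0 subr0.
  apply: (@near_eq_is_derive _ _ _ (cst 0)).
  near=> s; rewrite flat_le0 // ltW //; near: s.
  exact: lt_nbhsl.
- pose g (s : R) := s^-1 ^+ m * expR (- s^-1).
  apply: (@near_eq_is_derive _ _ _ g).
    near=> s; rewrite /flat /g ifT //; near: s.
    exact: lt_nbhsr.
  rewrite /flat t0.
  have tn0 : t != 0 by rewrite gt_eqF.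
  have di : is_derive t 1 (fun s : R => s^-1) (- t ^- 2).
    have := @is_deriveV R id t 1 1 tn0 (is_derive_id _ _).
    by rewrite /= [_ *: _]mulr1.
  have dX := is_deriveX m di.
  have dE : is_derive t 1 (fun s : R => expR (- s^-1)) (t^-1 ^+2 * expR (- t^-1)).
    have dn : is_derive t 1 (fun s : R => - s^-1) (t ^- 2).
      by have := is_deriveN di; rewrite opprK.
    have := @is_derive1_comp R expR (fun s : R => - s^-1) t _ _ (is_derive_expR _) dn.
    by rewrite exprVn mulrC.
  have H := is_deriveM dX dE.
  have -> : g = (fun s : R => s^-1) ^+ m * (fun s : R => expR (- s^-1)).
    by apply/funext => s; rewrite /g /GRing.mul /= exprfctE.
  apply: (@is_derive_eq _ _ _ _ _ _ _ _ H).
  rewrite /GRing.scale /= exprfctE -exprVn.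
  clear; case: m => [|m]; first by rewrite mulr0n; ring.
  by rewrite [m.+1.-1]/= !exprS; ring.
- rewrite !flat_le0 // mulr0 subr0.
  (* The difference quotient of [flat m] at 0 is [flat m.+1 h], whose limit at 0 is known. *)
  have H : h^-1 *: ((flat m \o shift 0) (h *: 1) - flat m 0) @[h --> 0^'] --> (0 : R).
    have := @flat_cvg0 m.+1; apply: cvg_trans; apply: near_eq_cvg.
    near=> h; rewrite /= addr0 (flat_le0 m (lexx 0)) subr0 /flat [h%:A]mulr1.
    by case: ifP => [_|_]; rewrite ?scaler0 // exprS -mulrA.
  apply: DeriveDef; first by apply/cvg_ex; exists 0.
  exact: cvg_lim.
Unshelve. all: by end_near.
Qed.

(** The induction on r runs over all m at once, because the derivative of [flat m] involves
    [flat m.+1] and [flat m.+2]. *)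
Lemma Ck_on_flat (V : normedModType R) r (U : set V) (a : V -> R) m :
  open U -> Ck_on r U a -> Ck_on r U (fun x => flat m (a x)).
Proof.
move=> oU; have df m' (t : R) : differentiable (flat m' : R -> R) t.
  by apply/derivable1_diffP; case: (is_derive_flat m' t).
elim: r m a => [|r IH] m a.
  move=> ca x Ux; apply: continuous_comp; first exact: ca.
  exact: differentiable_continuous.
move=> ar; have [a1 a2] := ar; have ap := Ck_on_pred ar; split=> [x Ux|v].
  by apply: differentiable_comp; [exact: a1|exact: df].
have : Ck_on r U (fun x => (flat m.+2 (a x) - m%:R * flat m.+1 (a x)) * 'D_v a x).
  apply: Ck_on_mul => //; last exact: a2.
  apply: (Ck_on_add (W := R) (g := fun x => - (m%:R * flat m.+1 (a x))) oU (IH _ _ ap)).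
  apply: (Ck_on_opp (W := R) oU); apply: Ck_on_mul => //; last exact: IH.
  exact: (Ck_on_cst (W := R)).
apply: eq_Ck_on => // x Ux.
have dax := a1 x Ux.
rewrite [RHS]deriveE; last exact: differentiable_comp.
rewrite (diff_comp dax (df m _)) /= -(deriveE v dax).
rewrite deriv1E; last by apply/derivable1_diffP; exact: df.
by rewrite derive1E (@derive_val _ _ _ _ _ _ _ (is_derive_flat m (a x))) mulrC.
Qed.
End Flat.

(** * Smooth maps and smooth matrix operations *)

Section SmoothOn.
Context {R : realType} {V : normedModType R}.
Implicit Types (U : set V).

Lemma smooth_onW (W : normedModType R) U O (f : V -> W) :
  O `<=` U -> smooth_on U f -> smooth_on O f.
Proof. by move=> OU sf r; exact: Ck_onW (sf r). Qed.

Lemma eq_smooth_on (W : normedModType R) U (f g : V -> W) :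
  open U -> (forall x, U x -> f x = g x) -> smooth_on U f -> smooth_on U g.
Proof. by move=> oU fg sf r; exact: eq_Ck_on (sf r). Qed.

Lemma smooth_on_local (W : normedModType R) U (f : V -> W) :
  (forall x, U x -> exists O, [/\ open O, O x & smooth_on O f]) -> smooth_on U f.
Proof.
move=> H r; apply: Ck_on_local => x /H[B [oB Bx sf]].
by exists B; split => //; exact: sf.
Qed.

Lemma smooth_on_differentiable (W : normedModType R) U (f : V -> W) x :
  smooth_on U f -> U x -> differentiable f x.
Proof. by move=> /(_ 1%N)[H _] /H. Qed.

Lemma smooth_on_continuous (W : normedModType R) U (f : V -> W) x :
  smooth_on U f -> U x -> {for x, continuous f}.
Proof. by move=> /(_ 0%N) H /H. Qed.

Lemma smooth_on_derive (W : normedModType R) U (f : V -> W) v :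
  smooth_on U f -> smooth_on U (fun x => 'D_v f x).
Proof. by move=> sf r; have [_ /(_ v)] := sf r.+1. Qed.

Lemma smooth_on_cst (W : normedModType R) U (c : W) : smooth_on U (fun=> c).
Proof. by move=> r; exact: Ck_on_cst. Qed.

Lemma smooth_on_linear (W : normedModType R) U (f : {linear V -> W}) :
  continuous f -> smooth_on U f.
Proof. by move=> cf r; exact: Ck_on_linear. Qed.

Lemma smooth_on_add (W : normedModType R) U (f g : V -> W) :
  open U -> smooth_on U f -> smooth_on U g -> smooth_on U (fun x => f x + g x).
Proof. by move=> oU sf sg r; exact: Ck_on_add. Qed.

Lemma smooth_on_opp (W : normedModType R) U (f : V -> W) :
  open U -> smooth_on U f -> smooth_on U (fun x => - f x).
Proof. by move=> oU sf r; exact: Ck_on_opp. Qed.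

Lemma smooth_on_sub (W : normedModType R) U (f g : V -> W) :
  open U -> smooth_on U f -> smooth_on U g -> smooth_on U (fun x => f x - g x).
Proof. by move=> oU sf sg; apply: smooth_on_add => //; exact: smooth_on_opp. Qed.

Lemma smooth_on_sum (W : normedModType R) U (I : Type) (s : seq I)
    (P : pred I) (f : I -> V -> W) :
  open U -> (forall i, P i -> smooth_on U (f i)) ->
  smooth_on U (fun x => \sum_(i <- s | P i) f i x).
Proof. by move=> oU H r; apply: Ck_on_sum => // i /H. Qed.

Lemma smooth_on_mul U (f g : V -> R) :
  open U -> smooth_on U f -> smooth_on U g -> smooth_on U (fun x => f x * g x).
Proof. by move=> oU sf sg r; exact: Ck_on_mul. Qed.

Lemma smooth_on_inv U (f : V -> R) :
  open U -> (forall x, U x -> f x != 0) -> smooth_on U f ->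
  smooth_on U (fun x => (f x)^-1).
Proof. by move=> oU f0 sf r; exact: Ck_on_inv. Qed.

Lemma smooth_on_prod U (I : Type) (s : seq I) (P : pred I) (f : I -> V -> R) :
  open U -> (forall i, P i -> smooth_on U (f i)) ->
  smooth_on U (fun x => \prod_(i <- s | P i) f i x).
Proof. by move=> oU H r; apply: Ck_on_prod => // i /H. Qed.

Lemma smooth_on_flat U (a : V -> R) m :
  open U -> smooth_on U a -> smooth_on U (fun x => flat m (a x)).
Proof. by move=> oU sa r; exact: Ck_on_flat. Qed.

Lemma smooth_on_coord m n U (f : V -> 'M[R]_(m, n)) i j :
  open U -> smooth_on U f -> smooth_on U (fun x => f x i j).
Proof. by move=> oU sf r; exact: (Ck_on_coord i j oU (sf r)). Qed.

Lemma smooth_on_mx m n U (f : V -> 'M[R]_(m, n)) :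
  open U -> (forall i j, smooth_on U (fun x => f x i j)) -> smooth_on U f.
Proof. by move=> oU H r; apply: Ck_on_mx => // i j; exact: H. Qed.

Lemma smooth_on_comp m p q U (O : set 'rV[R]_m) (h : V -> 'rV[R]_m)
    (g : 'rV[R]_m -> 'M[R]_(p, q)) :
  open U -> open O -> (forall x, U x -> O (h x)) ->
  smooth_on U h -> smooth_on O g -> smooth_on U (fun x => g (h x)).
Proof. by move=> oU oO UO sh sg r; exact: (Ck_on_comp oU oO UO (sh r) (sg r)). Qed.

Lemma smooth_on_comp_scalar m U (O : set 'rV[R]_m) (h : V -> 'rV[R]_m)
    (g : 'rV[R]_m -> R) :
  open U -> open O -> (forall x, U x -> O (h x)) ->
  smooth_on U h -> smooth_on O g -> smooth_on U (fun x => g (h x)).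
Proof. by move=> oU oO UO sh sg r; exact: (Ck_on_comp_scalar oU oO UO (sh r) (sg r)). Qed.

Lemma smooth_on_scale m n U (a : V -> R) (A : V -> 'M[R]_(m, n)) :
  open U -> smooth_on U a -> smooth_on U A -> smooth_on U (fun x => a x *: A x).
Proof.
move=> oU sa sA; apply: smooth_on_mx => // i j.
under eq_fun do rewrite mxE.
by apply: smooth_on_mul => //; exact: smooth_on_coord.
Qed.

Lemma smooth_on_mulmx m n p U (A : V -> 'M[R]_(m, n)) (B : V -> 'M[R]_(n, p)) :
  open U -> smooth_on U A -> smooth_on U B -> smooth_on U (fun x => A x *m B x).
Proof.
move=> oU sA sB; apply: smooth_on_mx => // i j.
under eq_fun do rewrite mxE.
apply: (smooth_on_sum (W := R)) => // k _.
by apply: smooth_on_mul => //; exact: smooth_on_coord.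
Qed.

Lemma smooth_on_trmx m n U (A : V -> 'M[R]_(m, n)) :
  open U -> smooth_on U A -> smooth_on U (fun x => (A x)^T).
Proof.
move=> oU sA; apply: smooth_on_mx => // i j.
by under eq_fun do rewrite mxE; exact: smooth_on_coord.
Qed.

Lemma smooth_on_det n U (A : V -> 'M[R]_n) :
  open U -> smooth_on U A -> smooth_on U (fun x => \det (A x)).
Proof.
move=> oU sA; apply: (smooth_on_sum (W := R)) => // s _.
apply: smooth_on_mul => //; first exact: (smooth_on_cst (W := R)).
by apply: smooth_on_prod => // i _; exact: smooth_on_coord.
Qed.

(** By Cramer's formula: cofactors and determinant are polynomial in the entries. *)
Lemma smooth_on_invmx n U (A : V -> 'M[R]_n) :
  open U -> (forall x, U x -> A x \in unitmx) -> smooth_on U A ->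
  smooth_on U (fun x => invmx (A x)).
Proof.
move=> oU Au sA.
have : smooth_on U (fun x => (\det (A x))^-1 *: \adj (A x)).
  apply: smooth_on_scale => //.
    apply: smooth_on_inv => //; last exact: smooth_on_det.
    by move=> x /Au; rewrite unitmxE unitfE.
  apply: smooth_on_mx => // i j; under eq_fun do rewrite mxE.
  apply: smooth_on_mul => //; first exact: (smooth_on_cst (W := R)).
  apply: smooth_on_det => //; apply: smooth_on_mx => // a b.
  by under eq_fun do rewrite !mxE; exact: smooth_on_coord.
by apply: eq_smooth_on => // x /Au Ax; rewrite /invmx Ax.
Qed.

Lemma derive_mulmx m n p (A : V -> 'M[R]_(m, n)) (B : V -> 'M[R]_(n, p)) x v :
  differentiable A x -> differentiable B x ->
  'D_v (fun y => A y *m B y) x = 'D_v A x *m B x + A x *m 'D_v B x.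
Proof.
move=> dA dB.
have dAe i j : derivable (fun y => A y i j) x v.
  by apply: (derivable_mxP A x v).1; exact: diff_derivable.
have dBe i j : derivable (fun y => B y i j) x v.
  by apply: (derivable_mxP B x v).1; exact: diff_derivable.
have E i j : (fun y => (A y *m B y) i j) = \sum_k (fun y => A y i k) * (fun y => B y k j).
  by apply/funext => y; rewrite mxE fct_sumE.
rewrite derive_mx; last first.
  apply/derivable_mxP => i j; rewrite E.
  by apply: derivable_sum => k; exact: derivableM.
apply/matrixP => i j; rewrite !mxE E derive_sum; last by move=> k; exact: derivableM.
rewrite -big_split; apply: eq_bigr => k _ /=; rewrite deriveM //.
rewrite (derive_mx (diff_derivable _)) // (derive_mx (M := B)); last exact: diff_derivable.
by rewrite !mxE addrC; congr (_ + _); exact: mulrC.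
Qed.

End SmoothOn.

(** Locked so that unification treats the Jacobian as an atom instead of unfolding it to the matrix
    of the differential. *)
HB.lock Definition jac (R : realType) m n (f : 'rV[R]_m -> 'rV[R]_n)
  (x : 'rV[R]_m) : 'M[R]_(m, n) := jacobian f x.

(** * Jacobian matrices *)

Section SmoothRow.
Context {R : realType}.

Lemma smooth_on_id (V : normedModType R) (U : set V) : smooth_on U (fun x => x).
Proof. by apply: (@smooth_on_linear _ _ _ _ idfun) => x; exact: cvg_id. Qed.

Lemma smooth_on_cst_mulmxr m n p (U : set 'M[R]_(m, n)) (A : 'M[R]_(n, p)) :
  open U -> smooth_on U (fun x => x *m A).
Proof.
by move=> oU; apply: smooth_on_mulmx => //; [exact: smooth_on_id|exact: smooth_on_cst].
Qed.

Lemma derive_mulmxr (V : normedModType R) m n p (A : V -> 'M[R]_(m, n))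
    (B : 'M[R]_(n, p)) x v :
  differentiable A x -> 'D_v (fun y => A y *m B) x = 'D_v A x *m B.
Proof.
move=> dA; rewrite (derive_mulmx v dA (differentiable_cst B x)).
by rewrite derive_cst mulmx0 addr0.
Qed.

Lemma derive_trmx (V : normedModType R) m n (A : V -> 'M[R]_(m, n)) x v :
  differentiable A x -> 'D_v (fun y => (A y)^T) x = ('D_v A x)^T.
Proof.
move=> dA.
have dAe i j : derivable (fun y => A y i j) x v.
  by apply: (derivable_mxP A x v).1; exact: diff_derivable.
have E i j : (fun y => (A y)^T i j) = (fun y => A y j i) by apply/funext => y; rewrite mxE.
rewrite derive_mx; last by apply/derivable_mxP => i j; rewrite E.
apply/matrixP => i j; rewrite !mxE E (derive_mx (M := A)) ?mxE //.
exact: diff_derivable.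
Qed.

Lemma mulmx_row_ext m n (A B : 'M[R]_(m, n)) :
  (forall v : 'rV[R]_m, v *m A = v *m B) -> A = B.
Proof. by move=> H; apply/row_matrixP => i; rewrite [LHS]rowE [RHS]rowE. Qed.

Lemma mul_jac m n (f : 'rV[R]_m -> 'rV[R]_n) (x v : 'rV[R]_m) :
  differentiable f x -> v *m jac f x = 'D_v f x.
Proof. by move=> df; rewrite jac.unlock deriveEjacobian. Qed.

Lemma diff_jac m n (f : 'rV[R]_m -> 'rV[R]_n) (x v : 'rV[R]_m) :
  'd f x v = v *m jac f x.
Proof. by rewrite jac.unlock /jacobian mul_rV_lin1. Qed.

Lemma near_eq_jac m n (f g : 'rV[R]_m -> 'rV[R]_n) (x : 'rV[R]_m) :
  (\near x, f x = g x) -> differentiable f x -> jac f x = jac g x.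
Proof.
move=> fg df; have dg := near_eq_differentiable fg df.
apply: mulmx_row_ext => v; rewrite (mul_jac v df) (mul_jac v dg).
exact: near_eq_derive.
Qed.

Lemma jac_comp m n p (f : 'rV[R]_m -> 'rV[R]_n) (g : 'rV[R]_n -> 'rV[R]_p)
    (x : 'rV[R]_m) :
  differentiable f x -> differentiable g (f x) ->
  jac (g \o f) x = jac f x *m jac g (f x).
Proof.
move=> df dg; apply: mulmx_row_ext => v; rewrite mulmxA -!diff_jac.
by rewrite (diff_comp df dg).
Qed.

Lemma jac_mulmxr m n (A : 'M[R]_(m, n)) (x : 'rV[R]_m) :
  jac (fun y : 'rV_m => y *m A) x = A.
Proof.
apply: mulmx_row_ext => v; rewrite mul_jac.
  by rewrite derive_mulmxr // derive_id.
by apply: (smooth_on_differentiable (smooth_on_cst_mulmxr A openT)).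
Qed.

Lemma jac_id m (x : 'rV[R]_m) : jac (fun y : 'rV_m => y) x = 1%:M.
Proof.
rewrite -[RHS](jac_mulmxr _ x); congr (jac _ _).
by apply/funext => y; rewrite mulmx1.
Qed.

Lemma smooth_on_jac m n (U : set 'rV[R]_m) (f : 'rV[R]_m -> 'rV[R]_n) :
  open U -> smooth_on U f -> smooth_on U (fun x => jac f x).
Proof.
move=> oU sf; apply: smooth_on_mx => // i j.
have : smooth_on U (fun x => ('D_(delta_mx 0 i) f x) 0 j).
  by apply: smooth_on_coord => //; exact: smooth_on_derive.
apply: eq_smooth_on => // x Ux; rewrite -mul_jac.
  by rewrite -rowE mxE.
exact: smooth_on_differentiable sf Ux.
Qed.

Lemma derive_comm_mx (V : normedModType R) m n (f : V -> 'M[R]_(m, n)) (U : set V)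
    (x u v : V) :
  open U -> smooth_on U f -> U x ->
  'D_u (fun y => 'D_v f y) x = 'D_v (fun y => 'D_u f y) x.
Proof.
move=> oU sf Ux.
have E w y : U y -> 'D_w f y = \matrix_(i, j) 'D_w (fun y => f y i j) y.
  by move=> Uy; apply/derive_mx/diff_derivable/(smooth_on_differentiable sf).
have E2 w w' i j : 'D_w (fun y => ('D_w' f y) i j) x = 'D_w (fun y => 'D_w' (fun z => f z i j) y) x.
  apply: near_eq_derive; near=> y; rewrite E ?mxE //; near: y.
  exact: open_nbhs_nbhs.
have EE w w' : 'D_w (fun y => 'D_w' f y) x =
    \matrix_(i, j) 'D_w (fun y => ('D_w' f y) i j) x.
  by apply/derive_mx/diff_derivable/(smooth_on_differentiable (smooth_on_derive _ sf)).
apply: etrans (EE u v) _; apply: etrans _ (esym (EE v u)).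
apply/matrixP => i j; rewrite [LHS]mxE [RHS]mxE.
apply: etrans (E2 _ _ _ _) _; apply: etrans _ (esym (E2 _ _ _ _)).
exact: (derive_comm _ _ oU (smooth_on_coord i j oU sf) Ux).
Unshelve. all: by end_near.
Qed.

Lemma open_preimage_in (T S : topologicalType) (U : set T) (B : set S) (f : T -> S) :
  open U -> open B -> (forall x, U x -> {for x, continuous f}) ->
  open (U `&` f @^-1` B).
Proof.
move=> oU oB cf; rewrite openE => x [Ux Bx]; apply: filterI; first exact: open_nbhs_nbhs.
by apply: cf => //; exact: open_nbhs_nbhs.
Qed.

Lemma open_unitmx n : open [set A : 'M[R]_n | A \in unitmx].
Proof.
have -> : [set A : 'M[R]_n | A \in unitmx] = setT `&` (fun A => \det A) @^-1` [set t : R | t != 0].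
  by apply/seteqP; split => A /=; rewrite unitmxE unitfE => //; case.
apply: open_preimage_in; [exact: openT|exact: open_neq|] => A _.
apply: (@smooth_on_continuous _ _ R setT) => //.
by apply: smooth_on_det; [exact: openT|exact: smooth_on_id].
Qed.

End SmoothRow.

(** * Kernels of families of bilinear forms *)

Section GramSum.
Context {R : realType}.

Lemma mulmx_tr_ge0 n (v : 'rV[R]_n) : 0 <= (v *m v^T) 0 0.
Proof. by rewrite mxE sumr_ge0 // => i _; rewrite mxE -expr2 sqr_ge0. Qed.

Lemma mulmx_tr_eq0 n (v : 'rV[R]_n) : (v *m v^T) 0 0 = 0 -> v = 0.
Proof.
rewrite mxE => /eqP; rewrite psumr_eq0; last by move=> i _; rewrite mxE -expr2 sqr_ge0.
move=> /allP H; apply/rowP => i; rewrite mxE.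
have := H i (mem_index_enum _); rewrite /= mxE -expr2 sqrf_eq0.
by move=> /eqP.
Qed.

(** Over the reals u G u^T is the sum of the squared norms of the u A_j, so the left kernel of this
    one symmetric matrix G is the common left kernel of the family. A statement on k forms becomes
    one on a single rank or determinant. *)
Definition gram_sum k m n (A : 'I_k -> 'M[R]_(m, n)) : 'M[R]_m :=
  \sum_j A j *m (A j)^T.

Lemma tr_gram_sum k m n (A : 'I_k -> 'M[R]_(m, n)) : (gram_sum A)^T = gram_sum A.
Proof.
rewrite /gram_sum raddf_sum /=; apply: eq_bigr => j _.
by rewrite trmx_mul trmxK.
Qed.

Lemma gram_sum_kerP k m n (A : 'I_k -> 'M[R]_(m, n)) (u : 'rV[R]_m) :
  u *m gram_sum A = 0 <-> forall j, u *m A j = 0.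
Proof.
split=> [H|H]; last first.
  by rewrite mulmx_sumr big1 // => j _; rewrite mulmxA H mul0mx.
have : (u *m gram_sum A *m u^T) 0 0 = 0 by rewrite H mul0mx mxE.
rewrite mulmx_sumr mulmx_suml summxE => /eqP.
have E j : (u *m (A j *m (A j)^T) *m u^T) = (u *m A j) *m (u *m A j)^T.
  by rewrite trmx_mul !mulmxA.
rewrite psumr_eq0; last by move=> j _; rewrite E mulmx_tr_ge0.
move=> /allP {}H j; apply: mulmx_tr_eq0.
by have := H j (mem_index_enum _); rewrite /= E => /eqP.
Qed.

Lemma gram_sum_unitP k m n (A : 'I_k -> 'M[R]_(m, n)) :
  gram_sum A \in unitmx <-> forall u : 'rV[R]_m, (forall j, u *m A j = 0) -> u = 0.
Proof.
split=> [U u /gram_sum_kerP H|H].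
  by rewrite -(mulmxK U u) H mul0mx.
rewrite -row_free_unit -kermx_eq0; apply/eqP/row_matrixP => i; rewrite row0.
apply/H/gram_sum_kerP; exact/sub_kermxP/row_sub.
Qed.

Lemma sub_bigcap_kermxP k m n (A : 'I_k -> 'M[R]_(m, n)) (u : 'rV[R]_m) :
  (u <= \bigcap_(j < k) kermx (A j))%MS <-> forall j, u *m A j = 0.
Proof.
split=> [/sub_bigcapmxP H j|H]; first exact/sub_kermxP/H.
by apply/sub_bigcapmxP => j _; apply/sub_kermxP.
Qed.

Lemma bigcap_kermx_eq0P k m (A : 'I_k -> 'M[R]_m) :
  (\bigcap_(j < k) kermx (A j))%MS = 0 <->
  forall u : 'rV[R]_m, (forall j, u *m A j = 0) -> u = 0.
Proof.
split=> [E u /sub_bigcap_kermxP|H].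
  by rewrite E submx0 => /eqP.
apply/row_matrixP => i; rewrite row0; apply/H/sub_bigcap_kermxP; exact: row_sub.
Qed.

Lemma rank_kermx_gram_sum k m (A : 'I_k -> 'M[R]_m) :
  \rank (kermx (gram_sum A)) = \rank (\bigcap_(j < k) kermx (A j))%MS.
Proof.
apply/eqP; rewrite eqn_leq; apply/andP; split; apply: mxrankS; apply/rV_subP => u.
  by move=> /sub_kermxP /gram_sum_kerP /sub_bigcap_kermxP.
by move=> /sub_bigcap_kermxP /gram_sum_kerP /sub_kermxP.
Qed.

(** If u (A + L K) = 0 then u A = - u L K, and K A = 0 gives u A A = 0; by symmetry of A this says
    that u A has norm 0. Hence u L K = 0, and u L = 0 because K L = 1. Finally u, being in the
    kernel of A, is a combination D K, with D = u L = 0. *)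
Lemma kermx_complement n r (A : 'M[R]_n) : A^T = A -> \rank (kermx A) = r ->
  exists (K : 'M[R]_(r, n)) (L : 'M[R]_(n, r)), K *m L = 1%:M /\ A + L *m K \in unitmx.
Proof.
move=> symA rA.
have [K [Kfree KA Kker]] : exists K : 'M[R]_(r, n),
    [/\ row_free K, K *m A = 0 & (kermx A <= K)%MS].
  move: r rA => r <-; exists (row_base (kermx A)); split.
  - exact: row_base_free.
  - by apply/sub_kermxP; rewrite eq_row_base.
  - by rewrite eq_row_base.
have [L KL] := row_freeP Kfree.
exists K, L; split=> //.
rewrite -row_free_unit -kermx_eq0; apply/eqP/row_matrixP => i; rewrite row0.
have : row i (kermx (A + L *m K)) *m (A + L *m K) = 0 by exact/sub_kermxP/row_sub.
move: (row _ _) => u; rewrite mulmxDr => /eqP; rewrite addr_eq0 => /eqP uA.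
have uAA : u *m A *m A = 0 by rewrite uA mulNmx !mulmxA -(mulmxA _ K) KA mulmx0 oppr0.
have uA0 : u *m A = 0.
  apply: mulmx_tr_eq0; rewrite trmx_mul symA mulmxA uAA mul0mx.
  by rewrite mxE.
have uL0 : u *m L = 0.
  by move: uA; rewrite uA0 mulmxA => /eqP; rewrite eq_sym oppr_eq0 => /eqP /(congr1 (mulmx^~ L));
    rewrite -mulmxA KL mulmx1 mul0mx.
have /submxP[D uD] : (u <= K)%MS by apply: submx_trans Kker; apply/sub_kermxP.
by move: uL0; rewrite uD -mulmxA KL mulmx1 => ->; rewrite mul0mx.
Qed.

Section Frame.
Variables (n r : nat) (A : 'M[R]_n) (K : 'M[R]_(r, n)) (L : 'M[R]_(n, r)).
Hypotheses (KL : K *m L = 1%:M) (uC : A + L *m K \in unitmx).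
Hypothesis rA : \rank (kermx A) = r.
Let F := K *m invmx (A + L *m K).

(** On the kernel of A the matrix A + L K acts as L K, and inverting it gives u = u L F. The lemma
    is applied at points x near a centre, with K and L kept from the centre. *)
Lemma frame_coord m (u : 'M[R]_(m, n)) : u *m A = 0 -> u = u *m L *m F.
Proof.
move=> uA; rewrite /F mulmxA.
by rewrite -[u *m L *m K]mulmxA -[u *m (L *m K)]add0r -uA -mulmxDr mulmxK.
Qed.

(** The kernel lies in the row space of F by [frame_coord]; F has only r rows, so comparing ranks
    turns the inclusion into an equality. *)
Lemma frame_eqmx : (F :=: kermx A)%MS.
Proof.
have sub : (kermx A <= F)%MS.
  have -> : kermx A = kermx A *m L *m F by exact/frame_coord/mulmx_ker.
  exact: submxMl.
have rF : (\rank F <= r)%N by exact: rank_leq_row.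
apply: eqmx_sym; apply/eqmxP; rewrite -(geq_leqif (mxrank_leqif_eq sub)).
by rewrite rA.
Qed.

Lemma frame_ker : F *m A = 0.
Proof. by apply/sub_kermxP; rewrite frame_eqmx. Qed.

(** [frame_coord] applied to F itself reads F = F L F, and F, of full row rank, cancels on the
    right. *)
Lemma frame_section : F *m L = 1%:M.
Proof.
have free : row_free F by rewrite -row_leq_rank frame_eqmx rA.
apply: (row_free_inj free); rewrite mul1mx.
by rewrite -frame_coord // frame_ker.
Qed.
End Frame.
End GramSum.

(** * Exterior derivative of a covector field *)

Section ExteriorDerivative.
Context {R : realType}.

(** Gram matrix of the exterior derivative of the one-form with coefficients t, with the convention
    dt(u, v) = (D_u t)(v) - (D_v t)(u). *)
Definition dcov m (t : 'rV[R]_m -> 'rV[R]_m) (z : 'rV[R]_m) : 'M[R]_m :=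
  jac t z - (jac t z)^T.

Lemma dcov_alt m (t : 'rV[R]_m -> 'rV[R]_m) z : (dcov t z)^T = - dcov t z.
Proof. by rewrite /dcov linearB /= trmxK opprB. Qed.

Lemma mulmx_form_ext m (A B : 'M[R]_m) :
  (forall u v : 'rV[R]_m, form A u v = form B u v) -> A = B.
Proof.
move=> H; apply/matrixP => i j; have := H (delta_mx 0 i) (delta_mx 0 j).
by rewrite /form -!rowE trmx_delta -!colE !mxE.
Qed.

Lemma form_trmx m (A : 'M[R]_m) (u v : 'rV[R]_m) : form A^T u v = form A v u.
Proof.
have -> : form A v u = ((v *m A *m u^T)^T) 0 0 by rewrite mxE.
by rewrite !trmx_mul trmxK mulmxA.
Qed.

Lemma form_submx m (A B : 'M[R]_m) (u v : 'rV[R]_m) : form (A - B) u v = form A u v - form B u v.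
Proof. by rewrite /form mulmxBr mulmxBl !mxE. Qed.

Lemma form_addmx m (A B : 'M[R]_m) (u v : 'rV[R]_m) : form (A + B) u v = form A u v + form B u v.
Proof. by rewrite /form mulmxDr mulmxDl !mxE. Qed.

Lemma form_dcov m (t : 'rV[R]_m -> 'rV[R]_m) z u v :
  differentiable t z ->
  form (dcov t z) u v = ('D_u t z *m v^T) 0 0 - ('D_v t z *m u^T) 0 0.
Proof.
by move=> dt; rewrite /dcov form_submx form_trmx /form (mul_jac u dt) (mul_jac v dt).
Qed.

Lemma form_pullback m p (J : 'M[R]_(m, p)) A (u v : 'rV[R]_m) :
  form (J *m A *m J^T) u v = form A (u *m J) (v *m J).
Proof. by rewrite /form trmx_mul !mulmxA. Qed.

(** Differentiating t' (h z) (jac h z)^T yields the pulled-back derivative of t' and t' paired with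
    the second derivative of h. The latter is symmetric by Schwarz and cancels on antisymmetrizing:
    d commutes with pullback. *)
Lemma dcov_pullback m (D D' : set 'rV[R]_m) (h t t' : 'rV[R]_m -> 'rV[R]_m) z :
  open D -> open D' -> smooth_on D h -> smooth_on D' t' ->
  (forall z, D z -> D' (h z)) ->
  (forall z, D z -> t z = t' (h z) *m (jac h z)^T) ->
  D z -> dcov t z = jac h z *m dcov t' (h z) *m (jac h z)^T.
Proof.
move=> oD oD' sh st' DD' E Dz.
have dh := smooth_on_differentiable sh Dz.
have dt' := smooth_on_differentiable st' (DD' z Dz).
have sth : smooth_on D (fun z => t' (h z)) by exact: smooth_on_comp oD oD' DD' sh st'.
have sJ : smooth_on D (fun z => (jac h z)^T).
  by apply: smooth_on_trmx => //; exact: smooth_on_jac.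
have dth := smooth_on_differentiable sth Dz.
have dJ := smooth_on_differentiable sJ Dz.
have nE : \near z, t' (h z) *m (jac h z)^T = t z.
  by near do apply/esym/E; exact: open_nbhs_nbhs.
have dt : differentiable t z.
  apply: near_eq_differentiable nE _.
  by apply: smooth_on_differentiable Dz; apply: smooth_on_mulmx.
pose H u v := 'D_u (fun y => 'D_v h y) z.
have HC u v : H u v = H v u by exact: derive_comm_mx sh Dz.
have DJ u v : 'D_u (fun y => (jac h y)^T) z *m v^T = (H u v)^T.
  have -> : H u v = 'D_u (fun y => ((jac h y)^T *m v^T)^T) z.
    apply: near_eq_derive; near=> y; rewrite trmx_mul !trmxK mul_jac //.
    by apply: smooth_on_differentiable sh _; near: y; exact: open_nbhs_nbhs.
  have -> : 'D_u (fun y => ((jac h y)^T *m v^T)^T) z =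
      ('D_u (fun y => (jac h y)^T *m v^T) z)^T.
    apply: derive_trmx; apply: smooth_on_differentiable Dz.
    by apply: (smooth_on_mulmx (B := fun=> v^T) oD sJ); exact: smooth_on_cst.
  by rewrite trmxK derive_mulmxr.
have Dth u : 'D_u (fun z => t' (h z)) z = 'D_(u *m jac h z) t' (h z).
  apply: etrans (esym (mul_jac u dth)) _.
  apply: etrans (congr1 (mulmx u) (jac_comp dh dt')) _.
  by rewrite mulmxA; exact: mul_jac.
have Dt u : 'D_u t z = 'D_(u *m jac h z) t' (h z) *m (jac h z)^T
     + t' (h z) *m 'D_u (fun y => (jac h y)^T) z.
  apply: etrans (esym (near_eq_derive u nE)) _.
  apply: etrans (derive_mulmx u dth dJ) _.
  exact: (congr1 (fun X => X *m (jac h z)^T + _) (Dth u)).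
have Ev u v : 'D_u t z *m v^T =
    'D_(u *m jac h z) t' (h z) *m (v *m jac h z)^T + t' (h z) *m (H u v)^T.
  apply: etrans (congr1 (fun X => X *m v^T) (Dt u)) _.
  apply: etrans (mulmxDl _ _ _) _; apply: congr2.
    by rewrite trmx_mul mulmxA.
  exact: etrans (esym (mulmxA _ _ _)) (congr1 _ (DJ u v)).
apply: mulmx_form_ext => u v; rewrite form_pullback (form_dcov _ _ dt) (form_dcov _ _ dt').
have E3 (A B C : 'M[R]_1) : (A + C) 0 0 - (B + C) 0 0 = A 0 0 - B 0 0.
  by rewrite [(A + C) 0 0]mxE [(B + C) 0 0]mxE opprD addrACA subrr addr0.
have Evu := etrans (Ev v u) (congr1 (fun X => _ + t' (h z) *m X^T) (HC v u)).
apply: etrans (congr2 (fun X Y : 'M_1 => X 0 0 - Y 0 0) (Ev u v) Evu) _.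
exact: (E3 ('D_(u *m jac h z) t' (h z) *m (v *m jac h z)^T)
  ('D_(v *m jac h z) t' (h z) *m (u *m jac h z)^T) (t' (h z) *m (H u v)^T)).
Unshelve. all: by end_near.
Qed.

(** The identity d d = 0: the six terms are second derivatives of t paired with the third vector,
    and they cancel in pairs by Schwarz. *)
Lemma ext_deriv_dcov m (D : set 'rV[R]_m) (t : 'rV[R]_m -> 'rV[R]_m) z u v w :
  open D -> smooth_on D t -> D z -> ext_deriv (dcov t) z u v w = 0.
Proof.
move=> oD st Dz.
pose H u v := 'D_u (fun y => 'D_v t y) z.
have HC u' v' : H u' v' = H v' u' by exact: derive_comm_mx st Dz.
have sJ : smooth_on D (fun z => jac t z) by exact: smooth_on_jac.
have dJ := smooth_on_differentiable sJ Dz.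
have DJ a b c : form ('D_a (fun y => jac t y) z) b c = (H a b *m c^T) 0 0.
  have -> : H a b = 'D_a (fun y => b *m jac t y) z.
    apply: near_eq_derive; near=> y; rewrite mul_jac //.
    by apply: smooth_on_differentiable st _; near: y; exact: open_nbhs_nbhs.
  rewrite (derive_mulmx a (differentiable_cst b z) dJ) derive_cst mul0mx add0r.
  by rewrite /form.
have DD a b c : form ('D_a (dcov t) z) b c = (H a b *m c^T) 0 0 - (H a c *m b^T) 0 0.
  rewrite -!DJ -[form _ c b]form_trmx -form_submx; congr (form _ _ _).
  have dT : differentiable (fun y => (jac t y)^T) z.
    by apply: smooth_on_differentiable Dz; exact: smooth_on_trmx.
  apply: etrans (deriveB (diff_derivable _) (diff_derivable _)) _ => //.
  by rewrite derive_trmx.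
have [g [gE gC]] : exists g : 'rV[R]_m -> 'rV[R]_m -> 'rV[R]_m -> R,
    (forall a b c, form ('D_a (dcov t) z) b c = g a b c - g a c b) /\
    (forall a b c, g a b c = g b a c).
  exists (fun a b c => (H a b *m c^T) 0 0); split=> a b c; first exact: DD.
  exact: (congr1 (fun X => (X *m c^T) 0 0) (HC a b)).
apply: etrans (congr2 +%R (congr2 (fun a b => a - b) (gE u v w) (gE v u w)) (gE w u v)) _.
by rewrite (gC v u) (gC w u) (gC w v); ring.
Unshelve. all: by end_near.
Qed.

End ExteriorDerivative.

(** * Charts, transition maps and local frames *)

Section ManifoldCharts.
Context {R : realType} (M : manifold R).
Local Notation n := (dim M).
Implicit Types c d e : chart R M n.

Definition overlap c d : set 'rV[R]_n := chart_cod c `&` chart_inv c @^-1` chart_dom d.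

Definition transition c d : 'rV[R]_n -> 'rV[R]_n := chart_map d \o chart_inv c.

Lemma open_chart_preimage c (U : set M) :
  open U -> open (chart_cod c `&` chart_inv c @^-1` U).
Proof.
move=> oU; apply: open_preimage_in => //; first exact: chart_cod_open.
exact: chart_inv_cont.
Qed.

Lemma open_chart_image c (D : set 'rV[R]_n) :
  open D -> open (chart_dom c `&` chart_map c @^-1` D).
Proof.
move=> oD; apply: (open_preimage_in (@chart_dom_open _ _ _ c) oD).
exact: chart_map_cont.
Qed.

Lemma open_overlap c d : open (overlap c d).
Proof. by apply: open_chart_preimage; exact: chart_dom_open. Qed.

Lemma overlap_map c d p : chart_dom c p -> chart_dom d p -> overlap c d (chart_map c p).
Proof.
move=> cp dp; split; first exact: chart_mapS.
by rewrite /preimage /= chart_mapK.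
Qed.

Lemma transition_map c d p : chart_dom c p -> transition c d (chart_map c p) = chart_map d p.
Proof. by move=> cp; rewrite /transition /= chart_mapK. Qed.

Lemma transition_cod c d x : overlap c d x -> chart_cod d (transition c d x).
Proof. by move=> [cx dx]; exact: chart_mapS. Qed.

Lemma transition_inv c d x : overlap c d x -> chart_inv d (transition c d x) = chart_inv c x.
Proof. by move=> [cx dx]; rewrite /transition /= chart_mapK. Qed.

Lemma smooth_transition c d : atlas M c -> atlas M d ->
  smooth_on (overlap c d) (transition c d).
Proof. by move=> ac ad; exact: atlas_compat. Qed.

Lemma differentiable_transition c d x : atlas M c -> atlas M d -> overlap c d x ->
  differentiable (transition c d) x.
Proof. by move=> ac ad; apply: smooth_on_differentiable; exact: smooth_transition. Qed.

(** Indexed by the point p and not by its coordinates, so that the cocycle identity holds with the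
    same p in all factors. *)
Definition trjac c d (p : M) : 'M[R]_n := jac (transition c d) (chart_map c p).

Lemma trjac_id c p : chart_dom c p -> trjac c c p = 1%:M.
Proof.
move=> cp; rewrite /trjac -[RHS](jac_id (chart_map c p)).
apply/esym/near_eq_jac.
  near=> x; rewrite /transition /= chart_invK //; near: x.
  by apply: open_nbhs_nbhs; split; [exact: chart_cod_open|exact: chart_mapS].
exact: (smooth_on_differentiable (@smooth_on_id _ _ setT)).
Unshelve. all: by end_near.
Qed.

Lemma trjac_comp c d e p : atlas M c -> atlas M d -> atlas M e ->
  chart_dom c p -> chart_dom d p -> chart_dom e p ->
  trjac c e p = trjac c d p *m trjac d e p.
Proof.
move=> ac ad ae cp dp ep; rewrite /trjac -(transition_map d cp).
have ocd := overlap_map cp dp; have oce := overlap_map cp ep.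
have ode := overlap_map dp ep; rewrite -(transition_map d cp) in ode.
rewrite -jac_comp; try exact: differentiable_transition.
apply: near_eq_jac; last exact: differentiable_transition.
near=> x; rewrite [LHS]/transition [RHS]/= /transition /= chart_mapK //.
have : overlap c d x by near: x; apply: open_nbhs_nbhs; split=> //; exact: open_overlap.
by case.
Unshelve. all: by end_near.
Qed.

Lemma trjac_inv c d p : atlas M c -> atlas M d ->
  chart_dom c p -> chart_dom d p -> trjac c d p *m trjac d c p = 1%:M.
Proof. by move=> ac ad cp dp; rewrite -trjac_comp // trjac_id. Qed.

Lemma trjac_unit c d p : atlas M c -> atlas M d ->
  chart_dom c p -> chart_dom d p -> trjac c d p \in unitmx.
Proof. by move=> ac ad cp dp; have /mulmx1_unit[] := trjac_inv ac ad cp dp. Qed.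

Section LocalForm.
Variable w : M -> 'M[R]_n.

Lemma local_formE c p : chart_dom c p ->
  local_form w c (chart_map c p) =
  trjac c (chart_at p) p *m w p *m (trjac c (chart_at p) p)^T.
Proof.
move=> cp; rewrite /local_form /trjac jac.unlock /transition /= chart_mapK //.
Qed.

Lemma local_form_center p :
  local_form w (chart_at p) (chart_map (chart_at p) p) = w p.
Proof.
by rewrite local_formE ?trjac_id ?trmx1 ?mulmx1 ?mul1mx //; exact: chart_at_dom.
Qed.

Lemma local_form_change c d p : atlas M c -> atlas M d ->
  chart_dom c p -> chart_dom d p ->
  local_form w c (chart_map c p) =
  trjac c d p *m local_form w d (chart_map d p) *m (trjac c d p)^T.
Proof.
move=> ac ad cp dp; rewrite !local_formE // (@trjac_comp c d) //.
- by rewrite trmx_mul !mulmxA.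
- exact: chart_at_atlas.
- exact: chart_at_dom.
Qed.
End LocalForm.

Lemma tr_local_form (w : two_form M) c x : (local_form w c x)^T = - local_form w c x.
Proof.
by rewrite /local_form !trmx_mul trmxK gram_alt mulNmx mulmxN mulmxA.
Qed.

(** The Jacobian from c to the preferred chart at p is invertible and carries the kernel computed in
    c onto the row space of [char_dist w p]. Thus constancy of the rank can be used in the
    coordinates of any fixed chart. *)
Lemma rank_local_kernel k (w : 'I_k -> two_form M) c p : atlas M c -> chart_dom c p ->
  \rank (kermx (gram_sum (fun j => local_form (w j) c (chart_map c p)))) =
  \rank (char_dist w p).
Proof.
move=> ac cp; rewrite rank_kermx_gram_sum.
have ad := chart_at_atlas p; have dp := chart_at_dom p.
have JU := trjac_unit ac ad cp dp.
have JK : trjac c (chart_at p) p *m trjac (chart_at p) c p = 1%:M by exact: trjac_inv.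
set J := trjac c _ p in JU JK *; set J' := trjac _ c p in JK *.
have JK' : J' *m J = 1%:M by exact: trjac_inv.
have J'free : row_free J' by rewrite row_free_unit; exact: trjac_unit.
have E (u : 'rV[R]_n) : (u <= \bigcap_(j < k) kermx (local_form (w j) c (chart_map c p)))%MS <->
    (u *m J <= char_dist w p)%MS.
  split=> [/sub_bigcap_kermxP H|/sub_bigcap_kermxP H]; apply/sub_bigcap_kermxP => j.
    have := H j; rewrite local_formE // -/J !mulmxA => /(congr1 (mulmx^~ (J'^T))).
    by rewrite -mulmxA -trmx_mul JK' trmx1 mulmx1 mul0mx.
  by rewrite local_formE // -/J !mulmxA H mul0mx.
rewrite -(mxrankMfree (char_dist w p) J'free).
apply/eqP; rewrite eqn_leq; apply/andP; split; apply: mxrankS; apply/rV_subP => u.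
  by move=> /E uJ; rewrite -[u]mulmx1 -JK mulmxA; exact: submxMr.
move=> /submxP[D ->]; apply/E; rewrite -!mulmxA JK' mulmx1; exact: submxMl.
Qed.

End ManifoldCharts.

Section Frames.
Context {R : realType} (M : manifold R) (k : nat) (w : 'I_k -> two_form M) (r : nat).
Local Notation n := (dim M).

(* [frame q] is a frame of the characteristic distribution over [frame_dom q],
   as a function of the coordinates in the chart [chart_at q]. *)
Record local_frames := LocalFrames {
  frame_dom : M -> set M;
  frame : M -> 'rV[R]_n -> 'M[R]_(r, n);
  frame_dual : M -> 'M[R]_(n, r);
  frame_dom_open : forall q, open (frame_dom q);
  frame_dom_center : forall q, frame_dom q q;
  frame_dom_sub : forall q, frame_dom q `<=` chart_dom (chart_at q);
  frame_smooth : forall q,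
    smooth_on (chart_cod (chart_at q) `&` chart_inv (chart_at q) @^-1` frame_dom q) (frame q);
  frameL : forall q p, frame_dom q p ->
    frame q (chart_map (chart_at q) p) *m frame_dual q = 1%:M;
  frame_in_ker : forall q p j, frame_dom q p ->
    frame q (chart_map (chart_at q) p) *m
      local_form (w j) (chart_at q) (chart_map (chart_at q) p) = 0;
  frame_span : forall q p m (u : 'M[R]_(m, n)), frame_dom q p ->
    (forall j, u *m local_form (w j) (chart_at q) (chart_map (chart_at q) p) = 0) ->
    u = u *m frame_dual q *m frame q (chart_map (chart_at q) p)
}.

Lemma local_frames_exist :
  (forall p, \rank (char_dist w p) = r) -> inhabited local_frames.
Proof.
move=> rw.
pose A q x := gram_sum (fun j => local_form (w j) (chart_at q) x).
have sA q : smooth_on (chart_cod (chart_at q)) (A q).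
  have oc : open (chart_cod (chart_at q)) by exact: chart_cod_open.
  apply: smooth_on_sum => // j _.
  by apply: smooth_on_mulmx => //; [|apply: smooth_on_trmx => //];
    by apply: gram_smooth; exact: chart_at_atlas.
have rA q p : chart_dom (chart_at q) p -> \rank (kermx (A q (chart_map (chart_at q) p))) = r.
  by move=> qp; rewrite rank_local_kernel // ?rw //; exact: chart_at_atlas.
have /choice[KL KLP] : forall q : M, exists KL : 'M[R]_(r, n) * 'M[R]_(n, r),
    KL.1 *m KL.2 = 1%:M /\
    A q (chart_map (chart_at q) q) + KL.2 *m KL.1 \in unitmx.
  move=> q; have := rA q q (chart_at_dom q).
  by move=> /(kermx_complement (tr_gram_sum _))[K [L KL]]; exists (K, L).
pose C q x := A q x + (KL q).2 *m (KL q).1.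
(* The frame is defined where the corrected matrix [C q] stays invertible: an open condition, true
   at q by the choice of K and L. *)
pose D q : set M := chart_dom (chart_at q) `&`
  chart_map (chart_at q) @^-1` (chart_cod (chart_at q) `&` C q @^-1` [set B | B \in unitmx]).
have oc q : open (chart_cod (chart_at q : chart R M n)) by exact: chart_cod_open.
have sC q : smooth_on (chart_cod (chart_at q)) (C q).
  apply: smooth_on_add => //; exact: smooth_on_cst.
have oD q : open (D q).
  apply: open_chart_image; apply: (open_preimage_in (f := C q) (oc q) (@open_unitmx R n)).
  by move=> x; exact: smooth_on_continuous.
have DC q p : D q p -> C q (chart_map (chart_at q) p) \in unitmx by case=> _ [].
have Dsub q : D q `<=` chart_dom (chart_at q) by move=> p [].
apply: inhabits.
apply: (@LocalFrames D (fun q x => (KL q).1 *m invmx (C q x)) (fun q => (KL q).2)) => //.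
- move=> q; split; first exact: chart_at_dom.
  by split; [exact/chart_mapS/chart_at_dom|case: (KLP q)].
- move=> q; apply: smooth_on_mulmx; first exact: open_chart_preimage.
    exact: smooth_on_cst.
  apply: smooth_on_invmx; first exact: open_chart_preimage.
    by move=> x [cx /DC]; rewrite chart_invK.
  by apply: smooth_onW (sC q) => x [].
- move=> q p Dp; apply: frame_section; [exact: DC|exact/rA/Dsub].
- move=> q p j Dp.
  have FA := frame_ker (DC q p Dp) (rA q p (Dsub q p Dp)).
  apply/row_matrixP => i; rewrite row0 row_mul; move: j; apply/gram_sum_kerP.
  by rewrite -row_mul -/(A q _) FA row0.
- move=> q p m u Dp H; apply: frame_coord; first exact: DC.
  apply/row_matrixP => i; rewrite row0 row_mul; apply/gram_sum_kerP => j.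
  by rewrite -row_mul H row0.
Qed.
End Frames.

(** * Locally finite smooth weights *)

Section Weights.
Context {R : realType} (M : manifold R).
Local Notation n := (dim M).

(** Lindelöf's argument: basic open sets have codes in nat, and each basic set contained in some
    [O q] selects one such q. *)
Lemma countable_subcover (p0 : M) (O : M -> set M) :
  (forall q, open (O q)) -> (forall q, O q q) ->
  exists s : nat -> M, forall p, exists i, O (s i) p.
Proof.
move=> oO Oq; have [B cB [Bo Bn]] := @second_countable_carrier R M.
have /countable_injP[f finj] := cB.
have /choice[s sP] : forall i, exists q, forall b, B b -> f b = i ->
    (exists q', b `<=` O q') -> b `<=` O q.
  move=> i; have [[b [Bb fb [q bq]]]|H] :=
    pselect (exists b, [/\ B b, f b = i & exists q', b `<=` O q']).
    exists q => b' Bb' fb' _; suff -> : b' = b by [].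
    by apply: finj; rewrite ?inE // fb fb'.
  (* Codes that belong to no suitable basic set receive the default centre [p0]. *)
  by exists p0 => b Bb fb bq; case: H; exists b.
exists s => p.
have [b [Bb bp] bO] : filter_from [set U | B U /\ U p] id (O p).
  by apply: Bn; exact: open_nbhs_nbhs.
by exists (f b); apply: (sP _ b) => //; exists p.
Qed.

Definition smooth_fun (f : M -> R) : Prop :=
  forall c, atlas M c -> smooth_on (chart_cod c) (f \o chart_inv c).

Lemma smooth_fun_continuous f : smooth_fun f -> continuous f.
Proof.
move=> sf p; pose c : chart R M n := chart_at p.
have cp : chart_dom c p by exact: chart_at_dom.
have cf : {for p, continuous ((f \o chart_inv c) \o chart_map c)}.
  apply: continuous_comp; first exact: chart_map_cont.
  by apply: smooth_on_continuous (sf c (chart_at_atlas p)) _; exact: chart_mapS.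
have E : (f \o chart_inv c \o chart_map c) p = f p by rewrite /= chart_mapK.
suff : f @ p --> f p by []; rewrite -E.
apply: cvg_trans cf; apply: near_eq_cvg.
near=> q; rewrite /= chart_mapK //; near: q.
by apply: open_nbhs_nbhs; split => //; exact: chart_dom_open.
Unshelve. all: by end_near.
Qed.

Lemma smooth_fun_mul f g : smooth_fun f -> smooth_fun g -> smooth_fun (fun p => f p * g p).
Proof.
by move=> sf sg c ac; apply: smooth_on_mul; [exact: chart_cod_open|exact: sf|exact: sg].
Qed.

Lemma smooth_fun_prod m (f : 'I_m -> M -> R) :
  (forall i, smooth_fun (f i)) -> smooth_fun (fun p => \prod_(i < m) f i p).
Proof.
move=> sf c ac; apply: smooth_on_prod; first exact: chart_cod_open.
by move=> i _; exact: sf.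
Qed.

Lemma smooth_fun_flat (a : R) f : smooth_fun f -> smooth_fun (fun p => flat 0 (a - f p)).
Proof.
move=> sf c ac; apply: smooth_on_flat; first exact: chart_cod_open.
apply: (smooth_on_sub (W := R)) => //; first exact: chart_cod_open.
  exact: (smooth_on_cst (W := R)).
exact: sf.
Qed.

(** The support lies in the image K of a compact coordinate box, which is closed because M is
    Hausdorff. The extension by zero is then smooth: the chart domain and the complement of K are
    open and cover M. *)
Lemma bump_function (q : M) (U : set M) :
  open U -> U q -> U `<=` chart_dom (chart_at q) ->
  exists a : M -> R, [/\ smooth_fun a, forall p, 0 <= a p, 0 < a q &
    exists K, [/\ closed K, K `<=` U & forall p, ~ K p -> a p = 0]].
Proof.
move=> oU Uq Udom; pose c : chart R M n := chart_at q.
have ac : atlas M c by exact: chart_at_atlas.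
pose x0 := chart_map c q.
have : nbhs x0 (chart_cod c `&` chart_inv c @^-1` U).
  apply: open_nbhs_nbhs; split; first exact: open_chart_preimage.
  split; first exact/chart_mapS/chart_at_dom.
  by rewrite /preimage /= chart_mapK //; exact: chart_at_dom.
move=> /nbhs_ballP[e /= e0 He]; pose d := e / 2.
have d0 : 0 < d by rewrite divr_gt0.
have de : d < e by rewrite ltr_pdivrMr // mulr_natr mulr2n ltrDl.
(* The closed ball of radius d around [x0] for the supremum norm, written as a product of segments
   to get compactness; d < e keeps it in the neighbourhood found above. *)
pose B := [set x : 'rV[R]_n | forall i, `[x0 0 i - d, x0 0 i + d]%classic (x ord0 i)].
have BD : B `<=` chart_cod c `&` chart_inv c @^-1` U.
  move=> x Bx; apply: He; split => // i j; rewrite ord1 -ball_normE /=.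
  apply: le_lt_trans de; rewrite ler_norml.
  by have := Bx j; rewrite /= in_itv /= => /andP[H1 H2]; apply/andP; split; lra.
pose K := chart_inv c @` B.
have cK : closed K.
  apply: compact_closed; first exact: hausdorff_carrier.
  apply: continuous_compact.
    apply: continuous_in_subspaceT => x; rewrite inE => /BD[cx _].
    exact: chart_inv_cont.
  apply: (@rV_compact R n (fun i => `[x0 0 i - d, x0 0 i + d]%classic)) => i.
  exact: segment_compact.
have KU : K `<=` U by move=> _ [x /BD[_ Ux] <-].
pose sq (x : 'rV[R]_n) := ((x - x0) *m (x - x0)^T) 0 0.
(* Nonzero only at Euclidean distance less than d from [x0], hence only inside the box B. *)
pose rho x := flat 0 (d ^+ 2 - sq x).
have rho0 x : ~ B x -> rho x = 0.
  move=> nB; rewrite /rho; case: (ltP 0 (d ^+ 2 - sq x)) => [H|/flat_le0 //].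
  case: nB => i /=; rewrite in_itv /=.
  have : (x 0 i - x0 0 i) ^+ 2 <= sq x.
    rewrite /sq mxE (bigD1 i) //= !mxE -expr2 lerDl sumr_ge0 // => j _.
    by rewrite !mxE -expr2 sqr_ge0.
  move=> H1; have : (x 0 i - x0 0 i) ^+ 2 < d ^+ 2 by apply: le_lt_trans H1 _; rewrite -subr_gt0.
  have -> : x ord0 i = x0 0 i + (x 0 i - x0 0 i) by rewrite addrC subrK.
  move: (x 0 i - x0 0 i) => y H2; rewrite !lerD2l.
  by apply/andP; split; rewrite leNgt; apply/negP => H3; nra.
have srho : smooth_on setT rho.
  apply: smooth_on_flat; first exact: openT.
  apply: (smooth_on_sub (W := R)); [exact: openT|exact: (smooth_on_cst (W := R))|].
  have s1 : smooth_on setT (fun x : 'rV[R]_n => x - x0).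
    by apply: smooth_on_sub; [exact: openT|exact: smooth_on_id|exact: smooth_on_cst].
  apply: smooth_on_coord; first exact: openT.
  by apply: smooth_on_mulmx => //; [exact: openT|apply: smooth_on_trmx => //; exact: openT].
pose a p := if pselect (chart_dom c p) then rho (chart_map c p) else 0.
have aE p : chart_dom c p -> a p = rho (chart_map c p) by rewrite /a; case: pselect.
have aK p : ~ K p -> a p = 0.
  move=> nK; rewrite /a; case: pselect => // cp; apply: rho0 => HB; apply: nK.
  by exists (chart_map c p) => //; exact: chart_mapK.
exists a; split.
- move=> d' ad'; apply: smooth_on_local => x d'x.
  have [Kp|nKp] := pselect (K (chart_inv d' x)).
    exists (overlap d' c); split; first exact: open_overlap.
      by split=> //; exact/Udom/KU.
    have : smooth_on (overlap d' c) (fun x => rho (transition d' c x)).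
      apply: (smooth_on_comp_scalar (O := setT)) => //; first exact: open_overlap.
      exact: openT.
      exact: smooth_transition.
    apply: eq_smooth_on; first exact: open_overlap.
    by move=> y [d'y cy]; rewrite /= aE.
  exists (chart_cod d' `&` chart_inv d' @^-1` (~` K)); split.
  - by apply: open_chart_preimage; rewrite openC.
  - by split.
  - apply: (eq_smooth_on (f := fun=> 0)).
    + by apply: open_chart_preimage; rewrite openC.
    + by move=> y [_ nK]; rewrite /= aK.
    + exact: (smooth_on_cst (W := R)).
- by move=> p; rewrite /a; case: pselect => [cp|ncp] //=; exact: flat_ge0.
- rewrite aE; last exact: chart_at_dom.
  apply: flat_gt0; rewrite /sq subrr mul0mx mxE subr0.
  by rewrite exprn_gt0.
- by exists K.
Qed.

(** With [h q] half the bump value at its centre, countably many sets where [a (s i)] exceeds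
    [h (s i)] cover M. On such a set the factor [b (s i)] vanishes, killing all weights of index
    greater than i: this is local finiteness. At a given p, the first index with [a (s i) p]
    positive has positive weight, since each earlier factor is [flat 0] of a positive number. *)
Lemma partition_weights (p0 : M) (U : M -> set M) :
  (forall q, open (U q)) -> (forall q, U q q) ->
  (forall q, U q `<=` chart_dom (chart_at q)) ->
  exists (s : nat -> M) (psi : nat -> M -> R),
    [/\ forall i, smooth_fun (psi i),
        forall i p, 0 <= psi i p,
        forall i (p : M), ~ U (s i) p -> nbhs p [set p' | psi i p' = 0],
        forall p : M, exists m, nbhs p [set p' | forall i, (m <= i)%N -> psi i p' = 0] &
        forall p, exists i, 0 < psi i p].
Proof.
move=> oU Uq Udom.
have /choice[a aP] : forall q, exists a : M -> R, [/\ smooth_fun a, forall p, 0 <= a p, 0 < a q &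
    exists K, [/\ closed K, K `<=` U q & forall p, ~ K p -> a p = 0]].
  by move=> q; exact: bump_function.
pose h q := a q q / 2.
have a0 q : 0 < a q q by case: (aP q).
have h0 q : 0 < h q by rewrite divr_gt0.
have [s sP] : exists s : nat -> M, forall p, exists i, h (s i) < a (s i) p.
  apply: (@countable_subcover p0 (fun q => [set p | h q < a q p])) => q /=.
    have -> : [set p | h q < a q p] = a q @^-1` [set t | h q < t] by [].
    apply: open_comp; last exact: open_gt.
    by move=> p _; apply: smooth_fun_continuous; case: (aP q).
  by rewrite ltr_pdivrMr // mulr_natr mulr2n ltrDl.
pose b q p := flat 0 (h q - a q p).
exists s, (fun i p => a (s i) p * \prod_(j < i) b (s j) p); split.
- move=> i; apply: smooth_fun_mul; first by case: (aP (s i)).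
  by apply: smooth_fun_prod => j; apply: smooth_fun_flat; case: (aP (s j)).
- move=> i p; rewrite mulr_ge0 //; first by case: (aP (s i)).
  by apply: prodr_ge0 => j _; exact: flat_ge0.
- move=> i p nUp; have [_ _ _ [K [cK KU K0]]] := aP (s i).
  near=> p'; rewrite /= K0 ?mul0r //; near: p'.
  by apply: open_nbhs_nbhs; split; [rewrite openC|move=> /KU].
- move=> p; have [i ip] := sP p; exists i.+1; near=> p' => /= m im.
  have ip' : h (s i) < a (s i) p'.
    near: p'; have ca : continuous (a (s i)).
      by apply: smooth_fun_continuous; case: (aP (s i)).
    apply: (ca p [set t | h (s i) < t]).
    by apply: open_nbhs_nbhs; split => //; exact: open_gt.
  rewrite (bigD1 (Ordinal im)) //= /b flat_le0 ?mul0r ?mulr0 //.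
  by rewrite subr_le0 ltW.
- move=> p; have ex : exists i, 0 < a (s i) p.
    by have [i ip] := sP p; exists i; apply: lt_trans ip.
  exists (ex_minn ex); case: ex_minnP => i ip imin.
  rewrite mulr_gt0 // prodr_gt0 // => j _; apply: flat_gt0.
  suff -> : a (s j) p = 0 by rewrite subr0.
  apply/eqP; rewrite eq_le; apply/andP; split; last by case: (aP (s j)).
  by rewrite leNgt; apply/negP => /imin; rewrite leqNgt ltn_ord.
Unshelve. all: by end_near.
Qed.
End Weights.

(** * Manifolds from gluing data *)

Section Glue.
Context {R : realType}.

(** The radius is a rational e' below e / 2 and the centre lies within e' of x, so the triangle
    inequality keeps the ball inside the one of radius e around x. *)
Lemma rational_ball_basis m (x : 'rV[R]_m) (D : set 'rV[R]_m) : nbhs x D ->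
  exists ce : 'rV[rat]_m * rat,
    ball (map_mx ratr ce.1 : 'rV[R]_m) (ratr ce.2) x /\
    ball (map_mx ratr ce.1 : 'rV[R]_m) (ratr ce.2) `<=` D.
Proof.
move=> /nbhs_ballP[e /= e0 eD].
have e2 : 0 < e / 2 by rewrite divr_gt0.
have [e' ] := rat_in_itvoo e2; rewrite in_itv /= => /andP[e'0 e'e].
have /choice[c cP] : forall i, exists q : rat, `|ratr q - x 0 i| < ratr e'.
  move=> i; have : x 0 i - ratr e' < x 0 i + ratr e' by lra.
  move=> /rat_in_itvoo[q]; rewrite in_itv /= => /andP[H1 H2].
  by exists q; rewrite ltr_norml; apply/andP; split; lra.
pose cc : 'rV[rat]_m := \row_i c i.
have cx : ball (map_mx ratr cc : 'rV[R]_m) (ratr e') x.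
  split => // i j; rewrite ord1 -ball_normE /= !mxE; exact: cP.
exists (cc, e'); split => //= y cy; apply: eD.
apply: (@le_ball _ _ x (ratr e' + ratr e')); first lra.
by apply: ball_triangle cy; exact: ball_sym.
Qed.

(** A bare set with charts, whose topology will be read off from them. [gseq] provides second
    countability. In [gsep], two points of a common chart are separated inside that chart, so
    separating sets are demanded only as the alternative. *)
Record glue_data (m : nat) := GlueData {
  gspace : Type;
  gindex : Type;
  gdom : gindex -> set gspace;
  gcod : gindex -> set 'rV[R]_m;
  gmap : gindex -> gspace -> 'rV[R]_m;
  ginv : gindex -> 'rV[R]_m -> gspace;
  gcod_open : forall i, open (gcod i);
  gmapS : forall i p, gdom i p -> gcod i (gmap i p);
  ginvS : forall i x, gcod i x -> gdom i (ginv i x);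
  gmapK : forall i p, gdom i p -> ginv i (gmap i p) = p;
  ginvK : forall i x, gcod i x -> gmap i (ginv i x) = x;
  gcenter : gspace -> gindex;
  gcenter_dom : forall p, gdom (gcenter p) p;
  goverlap_open : forall i j, open (gcod i `&` ginv i @^-1` gdom j);
  gsmooth : forall i j,
    smooth_on (gcod i `&` ginv i @^-1` gdom j) (gmap j \o ginv i);
  gseq : nat -> gindex;
  gseq_cover : forall p, exists i, gdom (gseq i) p;
  gsep : forall p q, p <> q ->
    (exists i, gdom i p /\ gdom i q) \/
    exists A B, [/\ A p, B q, A `&` B = set0,
      forall i, open (gcod i `&` ginv i @^-1` A) &
      forall i, open (gcod i `&` ginv i @^-1` B)]
}.

(** A name for the underlying set that remembers G, on which the topology of the charts can be
    registered. *)
Definition glued m (G : glue_data m) : Type := gspace G.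

Section Topology.
Variables (m : nat) (G : glue_data m).

Definition glued_open (A : set (glued G)) :=
  forall i : gindex G, open (gcod i `&` ginv i @^-1` A).

Lemma glued_openT : glued_open setT.
Proof. by move=> i; rewrite preimage_setT setIT; exact: gcod_open. Qed.

Lemma glued_openI : setI_closed glued_open.
Proof. by move=> A B oA oB i; rewrite preimage_setI setIIr; exact: openI. Qed.

Lemma glued_open_bigU (I : Type) (f : I -> set (glued G)) :
  (forall i, glued_open (f i)) -> glued_open (\bigcup_i f i).
Proof.
move=> of_ i; rewrite preimage_bigcup setI_bigcupr.
by apply: bigcup_open => j _; exact: of_.
Qed.

HB.instance Definition _ := gen_eqMixin (glued G).
HB.instance Definition _ := gen_choiceMixin (glued G).
HB.instance Definition _ := isOpenTopological.Build (glued G)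
  glued_openT glued_openI glued_open_bigU.

Lemma glued_openE (A : set (glued G)) : open A = glued_open A.
Proof. by []. Qed.

Lemma glued_dom_open (i : gindex G) : open (gdom i : set (glued G)).
Proof. by move=> j; exact: goverlap_open. Qed.

Lemma glued_map_open (i : gindex G) (D : set 'rV[R]_m) : open D ->
  open (gdom i `&` gmap i @^-1` D : set (glued G)).
Proof.
move=> oD; rewrite glued_openE => j.
have -> : gcod j `&` ginv j @^-1` (gdom i `&` gmap i @^-1` D) =
    (gcod j `&` ginv j @^-1` gdom i) `&` (gmap i \o ginv j) @^-1` D.
  by rewrite preimage_setI setIA.
apply: (open_preimage_in (@goverlap_open _ G j i) oD).
by move=> x; apply: smooth_on_continuous; exact: gsmooth.
Qed.

Definition glued_chart (i : gindex G) : chart R (glued G) m.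
Proof.
refine (@Chart R (glued G) m (gdom i) (gcod i) (gmap i) (ginv i)
  (@glued_dom_open i) (@gcod_open _ G i) (@gmapS _ G i) (@ginvS _ G i)
  (@gmapK _ G i) (@ginvK _ G i) _ _).
- move=> p ip D; rewrite nbhsE => -[D' [oD' D'p] D'D].
  have : nbhs (p : glued G) (gdom i `&` gmap i @^-1` D').
    by apply: open_nbhs_nbhs; split => //; exact: glued_map_open.
  by apply: filterS => q [_ /D'D].
- move=> x ix A; rewrite nbhsE => -[A' [oA' A'x] A'A].
  have : nbhs x (gcod i `&` ginv i @^-1` A').
    by apply: open_nbhs_nbhs; split => //; exact: oA'.
  by apply: filterS => y [_ /A'A].
Defined.

Lemma glued_hausdorff : hausdorff_space (glued G).
Proof.
rewrite open_hausdorff => p q /eqP npq;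
have [[i [ip iq]]|[A [B [Ap Bq AB oA oB]]]] := @gsep _ G p q npq.
  have : gmap i p != gmap i q.
    by apply/eqP => E; apply: npq; rewrite -(gmapK ip) E (gmapK iq).
  have := @norm_hausdorff R 'rV[R]_m; rewrite open_hausdorff => /[apply].
  move=> [[A B] /=]; rewrite !inE => -[Ap Bq] [oA oB AB].
  exists (gdom i `&` gmap i @^-1` A, gdom i `&` gmap i @^-1` B) => /=.
    by rewrite !inE.
  split; try exact: glued_map_open.
  by apply/eqP; rewrite setIACA setIid -preimage_setI AB preimage_set0 setI0.
by exists (A, B); rewrite ?inE //=; split => //; apply/eqP.
Qed.

Lemma glued_second_countable : @second_countable (glued G).
Proof.
pose V (t : nat * ('rV[rat]_m * rat)) : set (glued G) :=
  gdom (gseq G t.1) `&` gmap (gseq G t.1) @^-1`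
    ball (map_mx ratr t.2.1 : 'rV[R]_m) (ratr t.2.2).
exists (range V).
  by apply: sub_countable (countableP [set: nat * ('rV[rat]_m * rat)]); exact: card_image_le.
split => [_ [t _ <-]|p A].
  by apply: glued_map_open; exact: ball_open.
rewrite nbhsE => -[A' [oA' A'p] A'A].
have [i ip] := gseq_cover p.
have : nbhs (gmap (gseq G i) p) (gcod (gseq G i) `&` ginv (gseq G i) @^-1` A').
  apply: open_nbhs_nbhs; split; first exact: oA'.
  by split; [exact: gmapS|rewrite /preimage /= gmapK].
move=> /rational_ball_basis[ce [xce ceA]].
exists (V (i, ce)); first by split; [exists (i, ce)|split].
move=> q [iq /ceA[_]]; rewrite /preimage /= gmapK //.
exact: A'A.
Qed.

Definition glued_manifold : manifold R.
Proof.
refine (@Manifold R (glued G) m (range glued_chart) (fun p => glued_chart (gcenter p))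
  glued_hausdorff glued_second_countable _ _ _).
- by move=> p; exists (gcenter p).
- by move=> p; exact: gcenter_dom.
- by move=> _ _ [i _ <-] [j _ <-]; exact: gsmooth.
Defined.
End Topology.
End Glue.

(** * The dual of the characteristic distribution *)

(** Used to replace a sum cut at a bound depending on the point by one with a fixed number of terms
    near a given point. *)
Lemma big_ord_tail0 (V : nmodType) (g : nat -> V) a b :
  (forall i, (a <= i)%N -> g i = 0) -> (forall i, (b <= i)%N -> g i = 0) ->
  \sum_(i < a) g i = \sum_(i < b) g i.
Proof.
have H c d : (forall i, (c <= i)%N -> g i = 0) -> \sum_(i < c + d) g i = \sum_(i < c) g i.
  move=> gc; elim: d => [|d IH]; first by rewrite addn0.
  by rewrite addnS big_ord_recr /= IH gc ?addr0 // leq_addr.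
by move=> /(H a b) <- /(H b a) <-; rewrite addnC.
Qed.

(** [gw_supp] gives vanishing in a whole neighbourhood, so that a term meaningful only over
    [U (gw_center i)] extends smoothly by zero. [gw_bound] is a pointwise cutoff that turns the
    locally finite sums into finite ones; it need not be locally constant. *)
Record gluing_weights (R : realType) (M : manifold R) (U : M -> set M) := GluingWeights {
  gw_center : nat -> M;
  gw : nat -> M -> R;
  gw_bound : M -> nat;
  gw_smooth : forall i, smooth_fun (gw i);
  gw_ge0 : forall i p, 0 <= gw i p;
  gw_supp : forall i (p : M), ~ U (gw_center i) p -> nbhs p [set p' | gw i p' = 0];
  gw_fin : forall p : M, exists m,
    nbhs p [set p' | forall i, (m <= i)%N -> gw i p' = 0];
  gw_pos : forall p, exists i, 0 < gw i p;
  gw_tail : forall p i, (gw_bound p <= i)%N -> gw i p = 0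
}.

Lemma gluing_weights_exist (R : realType) (M : manifold R) (p0 : M) (U : M -> set M) :
  (forall q, open (U q)) -> (forall q, U q q) ->
  (forall q, U q `<=` chart_dom (chart_at q)) -> inhabited (gluing_weights U).
Proof.
move=> oU Uq Udom.
have [s [psi [H1 H2 H3 H4 H5]]] := partition_weights p0 oU Uq Udom.
have /choice[N HN] : forall p, exists m, forall i, (m <= i)%N -> psi i p = 0.
  by move=> p; have [m /nbhs_singleton] := H4 p; exists m.
exact: (inhabits (GluingWeights H1 H2 H3 H4 H5 HN)).
Qed.

Section Connection.
Context {R : realType} (M : manifold R) (k : nat) (w : 'I_k -> two_form M) (r : nat).
Variable fr : local_frames w r.
Local Notation n := (dim M).
Local Notation cM q := (chart_at (q : M) : chart R M n).
Local Notation U := (frame_dom fr).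
Local Notation F q p := (frame fr q (chart_map (cM q) p)).
Local Notation L := (frame_dual fr).

Let ac q : atlas M (cM q). Proof. exact: chart_at_atlas. Qed.
Let Udom q p : U q p -> chart_dom (cM q) p. Proof. exact: frame_dom_sub. Qed.

Definition fchange (q q' p : M) : 'M[R]_r := F q p *m trjac (cM q) (cM q') p *m L q'.

(** Moved to the chart of q', the rows of the frame of q still lie in the characteristic
    distribution. [frame_span] expands them in the frame of q', with the coefficients that [fchange]
    reads off through the dual [L q']. *)
Lemma frame_trjac q q' p : U q p -> U q' p ->
  F q p *m trjac (cM q) (cM q') p = fchange q q' p *m F q' p.
Proof.
move=> qp q'p; have [dq dq'] := (Udom qp, Udom q'p).
apply: frame_span => // j.
have := frame_in_ker j qp.
rewrite (local_form_change _ (ac q) (ac q') dq dq') !mulmxA.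
move=> /(congr1 (mulmx^~ (trjac (cM q') (cM q) p)^T)).
by rewrite -mulmxA -trmx_mul trjac_inv // trmx1 mulmx1 mul0mx.
Qed.

Lemma fchange_comp q q' q'' p : U q p -> U q' p -> U q'' p ->
  fchange q q'' p = fchange q q' p *m fchange q' q'' p.
Proof.
move=> qp q'p q''p; rewrite {1}/fchange.
rewrite (trjac_comp (ac q) (ac q') (ac q'') (Udom qp) (Udom q'p) (Udom q''p)).
by rewrite mulmxA frame_trjac // /fchange !mulmxA.
Qed.

Lemma fchange_id q p : U q p -> fchange q q p = 1%:M.
Proof.
by move=> qp; rewrite /fchange trjac_id ?mulmx1 ?frameL //; exact: Udom.
Qed.

Lemma smooth_fchange c a b : atlas M c ->
  smooth_on (chart_cod c `&` chart_inv c @^-1` (U a `&` U b)) (fchange a b \o chart_inv c).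
Proof.
move=> Hc; set D := (X in smooth_on X _).
have oD : open D.
  by apply: open_chart_preimage; apply: openI; exact: frame_dom_open.
have Da x : D x -> overlap c (cM a) x by move=> [cx [ax _]]; split => //; exact: Udom.
have st : smooth_on D (transition c (cM a)).
  by apply: smooth_onW (smooth_transition Hc (ac a)).
apply: smooth_on_mulmx => //; last exact: smooth_on_cst.
apply: smooth_on_mulmx => //.
  apply: (smooth_on_comp (O := chart_cod (cM a) `&` chart_inv (cM a) @^-1` U a)) => //.
  - by apply: open_chart_preimage; exact: frame_dom_open.
  - move=> x Dx; split; first exact/transition_cod/Da.
    by rewrite /preimage /= (transition_inv (Da x Dx)); case: Dx => _ [].
  - exact: frame_smooth.
apply: (smooth_on_comp (O := overlap (cM a) (cM b))
  (g := fun x => jac (transition (cM a) (cM b)) x)) => //.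
- exact: open_overlap.
- move=> x Dx; have [cx [ax bx]] := Dx.
  by apply: overlap_map; exact: Udom.
- by apply: smooth_on_jac; [exact: open_overlap|exact: smooth_transition].
Qed.

Variable W : gluing_weights (frame_dom fr).
Local Notation s := (gw_center W).
Local Notation psi := (gw W).
Local Notation N := (gw_bound W).

Lemma gw_dom i p : psi i p != 0 -> U (s i) p.
Proof.
by move=> /eqP H; apply: contrapT => /gw_supp /nbhs_singleton.
Qed.

(** The local projection u |-> u L F around [s i]: tangent coordinates are moved to the chart of
    [s i], the dual L extracts frame coefficients, and [fchange] converts these to the frame of
    q. *)
Definition conn_term (q : M) i (p : M) : 'M[R]_(n, r) :=
  psi i p *: (trjac (cM q) (cM (s i)) p *m L (s i) *m fchange (s i) q p).

(** The bundle map Q, as the matrix from tangent coordinates to coefficients in the frame of q; in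
    coordinates Q is [conn q p *m F q p]. *)
Definition conn (q p : M) : 'M[R]_(n, r) := \sum_(i < N p) conn_term q i p.

Definition weight (p : M) : R := \sum_(i < N p) psi i p.

Lemma weight_gt0 p : 0 < weight p.
Proof.
have [i ip] := gw_pos W p.
have iN : (i < N p)%N.
  by rewrite ltnNge; apply/negP => /gw_tail ip0; rewrite ip0 ltxx in ip.
rewrite /weight (bigD1 (Ordinal iN)) //= ltr_pwDl // sumr_ge0 // => j _; exact: gw_ge0.
Qed.

(** Each term obeys the cocycle rules of [trjac] and [fchange], so Q does not depend on the chart
    and frame that express it. *)
Lemma conn_change q q' p : U q p -> U q' p ->
  conn q p = trjac (cM q) (cM q') p *m conn q' p *m fchange q' q p.
Proof.
move=> qp q'p; rewrite /conn mulmx_sumr mulmx_suml; apply: eq_bigr => i _.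
rewrite /conn_term -scalemxAr -scalemxAl.
have [->|/gw_dom ip] := eqVneq (psi i p) 0; first by rewrite !scale0r.
rewrite (trjac_comp (ac q) (ac q') (ac _) (Udom qp) (Udom q'p) (Udom ip)).
by rewrite (@fchange_comp _ q' q) // !mulmxA.
Qed.

(** Each local projection is the identity on V, as [fchange] to the frame of [s i] and back is 1;
    only the weights remain in the sum. *)
Lemma frame_conn q p : U q p -> F q p *m conn q p = (weight p)%:M.
Proof.
move=> qp; rewrite /conn mulmx_sumr /weight raddf_sum; apply: eq_bigr => i _ /=.
rewrite /conn_term -scalemxAr.
have -> : F q p *m (trjac (cM q) (cM (s i)) p *m L (s i) *m fchange (s i) q p) =
    fchange q (s i) p *m fchange (s i) q p by rewrite /fchange !mulmxA.
have [->|/gw_dom ip] := eqVneq (psi i p) 0; first by rewrite scale0r raddf0.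
by rewrite -fchange_comp // fchange_id // scalemx1.
Qed.

(** Near a given point the sum has a fixed number of terms. Each of them is smooth where its own
    frame is defined, and at any other point it vanishes in a neighbourhood by [gw_supp]. *)
Lemma smooth_conn q :
  smooth_on (chart_cod (cM q) `&` chart_inv (cM q) @^-1` U q) (conn q \o chart_inv (cM q)).
Proof.
apply: smooth_on_local => x [cx qx].
have [m] := gw_fin W (chart_inv (cM q) x); rewrite nbhsE => -[A [oA Ax] A0].
pose D := chart_cod (cM q) `&` chart_inv (cM q) @^-1` (U q `&` A).
have oD : open D by apply: open_chart_preimage; apply: openI => //; exact: frame_dom_open.
exists D; split => //.
have : smooth_on D (fun x => \sum_(i < m) conn_term q i (chart_inv (cM q) x)).
  apply: smooth_on_sum => // i _; apply: smooth_on_local => y [cy [qy Ay]].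
  have [iy|/gw_supp] := pselect (U (s i) (chart_inv (cM q) y)).
    pose D' := chart_cod (cM q) `&` chart_inv (cM q) @^-1` (U (s i) `&` U q).
    have oD' : open D'.
      by apply: open_chart_preimage; apply: openI; exact: frame_dom_open.
    have D'o : D' `<=` overlap (cM q) (cM (s i)).
      by move=> z [cz [iz _]]; split => //; exact: Udom.
    exists D'; split => //; apply: smooth_on_scale => //.
      by apply: smooth_onW ((@gw_smooth _ _ _ W i _ (ac q))) => z [].
    apply: smooth_on_mulmx => //; last exact: (smooth_fchange _ _ (ac q)).
    apply: smooth_on_mulmx => //; last exact: smooth_on_cst.
    have : smooth_on D' (fun x => jac (transition (cM q) (cM (s i))) x).
      apply: smooth_on_jac => //; apply: smooth_onW D'o _.
      exact: smooth_transition.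
    apply: eq_smooth_on => // z [cz _].
    by rewrite /trjac chart_invK.
  rewrite nbhsE => -[B [oB By] B0].
  exists (chart_cod (cM q) `&` chart_inv (cM q) @^-1` B).
  have oDB : open (chart_cod (cM q) `&` chart_inv (cM q) @^-1` B) by exact: open_chart_preimage.
  split => //; apply: (eq_smooth_on (f := fun=> 0)) => //; last exact: smooth_on_cst.
  by move=> z [cz /B0 z0]; rewrite /conn_term z0 scale0r.
apply: eq_smooth_on => // y [cy [qy /A0 y0]];
apply: (big_ord_tail0 (g := fun i => conn_term q i (chart_inv (cM q) y))) => i im.
  by rewrite /conn_term y0 // scale0r.
by rewrite /conn_term gw_tail // scale0r.
Qed.

End Connection.

(** * Block projections of R^(n + r) *)

Section Projections.
Context {R : realType} {n r : nat}.

(** Splitting by matrix products keeps base and fibre components inside the matrix calculus; [pr1^T]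
    and [pr2^T] are the corresponding inclusions. *)
Definition pr1 : 'M[R]_(n + r, n) := col_mx 1%:M 0.
Definition pr2 : 'M[R]_(n + r, r) := col_mx 0 1%:M.

Lemma pr1K : pr1^T *m pr1 = 1%:M.
Proof. by rewrite /pr1 tr_col_mx mul_row_col trmx1 trmx0 mulmx1 mulmx0 addr0. Qed.

Lemma pr2K : pr2^T *m pr2 = 1%:M.
Proof. by rewrite /pr2 tr_col_mx mul_row_col trmx1 trmx0 mulmx1 mul0mx add0r. Qed.

Lemma pr1_pr2 : pr1^T *m pr2 = 0.
Proof. by rewrite /pr1 /pr2 tr_col_mx mul_row_col trmx1 trmx0 mulmx0 mul0mx addr0. Qed.

Lemma pr2_pr1 : pr2^T *m pr1 = 0.
Proof. by rewrite -[LHS]trmxK trmx_mul trmxK pr1_pr2 trmx0. Qed.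

Lemma mulmx_pr1K m (x : 'M[R]_(m, n)) : x *m pr1^T *m pr1 = x.
Proof. by rewrite -mulmxA pr1K mulmx1. Qed.

Lemma mulmx_pr1_pr2 m (x : 'M[R]_(m, n)) : x *m pr1^T *m pr2 = 0.
Proof. by rewrite -mulmxA pr1_pr2 mulmx0. Qed.

Lemma row_mx_pr1 m (x : 'M[R]_(m, n)) (y : 'M_(m, r)) : row_mx x y *m pr1 = x.
Proof. by rewrite mul_row_col mulmx1 mulmx0 addr0. Qed.

Lemma row_mx_pr2 m (x : 'M[R]_(m, n)) (y : 'M_(m, r)) : row_mx x y *m pr2 = y.
Proof. by rewrite mul_row_col mulmx1 mulmx0 add0r. Qed.

Lemma row_mx_pr m (z : 'M[R]_(m, n + r)) : row_mx (z *m pr1) (z *m pr2) = z.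
Proof. by rewrite -[z]hsubmxK row_mx_pr1 row_mx_pr2. Qed.

Lemma pr_ext m (z z' : 'M[R]_(m, n + r)) :
  z *m pr1 = z' *m pr1 -> z *m pr2 = z' *m pr2 -> z = z'.
Proof. by move=> E1 E2; rewrite -[z]row_mx_pr E1 E2 row_mx_pr. Qed.

Lemma row_mxE0 m (x : 'M[R]_(m, n)) : row_mx x 0 = x *m pr1^T.
Proof. by rewrite tr_col_mx trmx1 trmx0 mul_mx_row mulmx1 mulmx0. Qed.

Lemma row_mx_sum m (x : 'M[R]_(m, n)) (y : 'M_(m, r)) :
  row_mx x y = x *m pr1^T + y *m pr2^T.
Proof.
by rewrite -row_mxE0 tr_col_mx trmx1 trmx0 mul_mx_row mulmx1 mulmx0 add_row_mx addr0 add0r.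
Qed.

End Projections.
#[global] Opaque pr1 pr2.

Lemma smooth_on_row_mx (R : realType) (V : normedModType R) m n r (U : set V)
    (f : V -> 'M[R]_(m, n)) (g : V -> 'M[R]_(m, r)) :
  open U -> smooth_on U f -> smooth_on U g -> smooth_on U (fun x => row_mx (f x) (g x)).
Proof.
move=> oU sf sg; under eq_fun do rewrite row_mx_sum.
apply: smooth_on_add => //; apply: smooth_on_mulmx => //; exact: smooth_on_cst.
Qed.

(** * The one-form theta and the two-forms in a bundle chart *)

Section LocalBundle.
Context {R : realType} (M : manifold R) (k : nat) (w : 'I_k -> two_form M) (r : nat).
Variables (fr : local_frames w r) (W : gluing_weights (frame_dom fr)).
Local Notation n := (dim M).
Local Notation cM q := (chart_at (q : M) : chart R M n).
Local Notation U := (frame_dom fr).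
Local Notation A := (fchange fr).

Let ac q : atlas M (cM q). Proof. exact: chart_at_atlas. Qed.
Let Udom q p : U q p -> chart_dom (cM q) p. Proof. exact: frame_dom_sub. Qed.

Definition base (q : M) (z : 'rV[R]_(n + r)) : M := chart_inv (cM q) (z *m pr1).

Definition bdom (q : M) (X : set M) : set 'rV[R]_(n + r) :=
  [set z | chart_cod (cM q) (z *m pr1)] `&` base q @^-1` X.

Lemma open_bdom q X : open X -> open (bdom q X).
Proof.
move=> oX.
have -> : bdom q X = setT `&` (fun z : 'rV[R]_(n + r) => z *m pr1) @^-1`
    (chart_cod (cM q) `&` chart_inv (cM q) @^-1` X) by rewrite setTI.
apply: open_preimage_in; [exact: openT|exact: open_chart_preimage|] => z _.
exact: (smooth_on_continuous (smooth_on_cst_mulmxr pr1 openT)).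
Qed.

Lemma smooth_on_base m p q X (g : 'rV[R]_n -> 'M[R]_(m, p)) : open X ->
  smooth_on (chart_cod (cM q) `&` chart_inv (cM q) @^-1` X) g ->
  smooth_on (bdom q X) (fun z => g (z *m pr1)).
Proof.
move=> oX sg; apply: smooth_on_comp sg => //.
- exact: open_bdom.
- exact: open_chart_preimage.
- exact/smooth_on_cst_mulmxr/open_bdom.
Qed.

(** The coefficients of theta: paired with u, this is the product of the fibre coordinates of z with
    the frame coefficients of Q applied to [u *m pr1]. The last factor [pr1^T] says that theta
    vanishes on vertical vectors. *)
Definition tautological (q : M) (z : 'rV[R]_(n + r)) : 'rV[R]_(n + r) :=
  z *m pr2 *m (conn W q (base q z))^T *m pr1^T.

Lemma smooth_tautological q : smooth_on (bdom q (U q)) (tautological q).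
Proof.
have oU : open (U q) by exact: frame_dom_open.
have oD := @open_bdom q _ oU.
apply: smooth_on_mulmx => //; last exact: smooth_on_cst.
apply: smooth_on_mulmx => //; first exact: smooth_on_cst_mulmxr.
apply: smooth_on_trmx => //.
exact: (smooth_on_base oU (smooth_conn W q)).
Qed.

Definition pulled_gram (j : 'I_k) (q : M) (z : 'rV[R]_(n + r)) : 'M[R]_(n + r) :=
  pr1 *m local_form (w j) (cM q) (z *m pr1) *m pr1^T.

Lemma smooth_pulled_gram j q : smooth_on (bdom q (U q)) (pulled_gram j q).
Proof.
have oU : open (U q) by exact: frame_dom_open.
have oD := @open_bdom q _ oU.
apply: smooth_on_mulmx => //; last exact: smooth_on_cst.
apply: smooth_on_mulmx => //; first exact: smooth_on_cst.
apply: (smooth_on_base oU); apply: smooth_onW (gram_smooth (w j) (ac q)).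
by move=> x [].
Qed.

(** The bundle projection is linear in coordinates, with constant Jacobian [pr1], so only the chain
    rule contributes. Closedness of omega_j thereby passes to its pullback. *)
Lemma form_derive_pulled_gram j q z a b c : bdom q (U q) z ->
  form ('D_a (pulled_gram j q) z) b c =
  form ('D_(a *m pr1) (local_form (w j) (cM q)) (z *m pr1)) (b *m pr1) (c *m pr1).
Proof.
move=> Dz; have oU : open (U q) by exact: frame_dom_open.
have oD := @open_bdom q _ oU.
have x0 : chart_cod (cM q) (z *m pr1) by case: Dz.
pose lf := local_form (w j) (cM q).
have slf : smooth_on (bdom q (U q)) (fun z => lf (z *m pr1)).
  apply: (smooth_on_base oU); apply: smooth_onW (gram_smooth (w j) (ac q)).
  by move=> x [].
have dlf : differentiable lf (z *m pr1).
  exact: smooth_on_differentiable (gram_smooth (w j) (ac q)) x0.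
have dpr : differentiable (fun z : 'rV[R]_(n + r) => z *m pr1 : 'rV[R]_n) z.
  exact: (smooth_on_differentiable (smooth_on_cst_mulmxr pr1 openT)).
have dlz := smooth_on_differentiable slf Dz.
have Dlz : 'D_a (fun z => lf (z *m pr1)) z = 'D_(a *m pr1) lf (z *m pr1).
  apply: etrans (deriveE a dlz) _; apply: etrans _ (esym (deriveE (a *m pr1) dlf)).
  apply: etrans (congr1 (fun f => f a) (diff_comp dpr dlf)) _ => /=.
  congr ('d lf _ _); apply: etrans (esym (deriveE a dpr)) _.
  by rewrite derive_mulmxr // derive_id.
have slz1 : smooth_on (bdom q (U q)) (fun z => (pr1 : 'M[R]_(n + r, n)) *m lf (z *m pr1)).
  exact: (smooth_on_mulmx oD (smooth_on_cst _ (pr1 : 'M[R]_(n + r, n))) slf).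
have dlz1 := smooth_on_differentiable slz1 Dz.
have DG : 'D_a (pulled_gram j q) z = pr1 *m 'D_(a *m pr1) lf (z *m pr1) *m pr1^T.
  apply: etrans (derive_mulmxr pr1^T a dlz1) _; apply: (congr1 (mulmx^~ _)).
  apply: etrans (derive_mulmx a (differentiable_cst _ _) dlz) _.
  by rewrite derive_cst mul0mx add0r; exact: (congr1 (mulmx pr1)).
by apply: etrans (congr1 (fun X => form X b c) DG) _; exact: form_pullback.
Qed.

Definition big_gram (j : 'I_k) (q : M) (z : 'rV[R]_(n + r)) : 'M[R]_(n + r) :=
  pulled_gram j q z + dcov (tautological q) z.

Lemma smooth_big_gram j q : smooth_on (bdom q (U q)) (big_gram j q).
Proof.
have oU : open (U q) by exact: frame_dom_open.
have oD := @open_bdom q _ oU.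
apply: smooth_on_add => //; first exact: smooth_pulled_gram.
have sJ := smooth_on_jac oD (@smooth_tautological q).
by apply: smooth_on_sub => //; exact: smooth_on_trmx.
Qed.

Lemma tr_big_gram j q z : (big_gram j q z)^T = - big_gram j q z.
Proof.
have E : (pulled_gram j q z)^T = - pulled_gram j q z.
  rewrite /pulled_gram; have := tr_local_form (w j) (cM q) (z *m pr1).
  move: (local_form _ _ _) => B HB.
  by rewrite !trmx_mul trmxK HB mulNmx mulmxN mulmxA.
by rewrite /big_gram opprD -E -dcov_alt raddfD.
Qed.

Lemma big_gram_closed j q z u v t : closed_form (w j) -> bdom q (U q) z ->
  ext_deriv (big_gram j q) z u v t = 0.
Proof.
move=> cw Dz.
have oU : open (U q) by exact: frame_dom_open.
have oD := @open_bdom q _ oU.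
have x0 : chart_cod (cM q) (z *m pr1) by case: Dz.
have dG := smooth_on_differentiable (@smooth_pulled_gram j q) Dz.
have dd : differentiable (dcov (tautological q)) z.
  have sJ := smooth_on_jac oD (@smooth_tautological q).
  apply: smooth_on_differentiable Dz.
  by apply: smooth_on_sub => //; exact: smooth_on_trmx.
have E a b c : form ('D_a (big_gram j q) z) b c =
   form ('D_(a *m pr1) (local_form (w j) (cM q)) (z *m pr1)) (b *m pr1) (c *m pr1) +
   form ('D_a (dcov (tautological q)) z) b c.
  rewrite -(form_derive_pulled_gram _ _ _ _ Dz) -form_addmx; apply: (congr1 (fun X => form X b c)).
  by apply: etrans (deriveD (diff_derivable _) (diff_derivable _)) _.
have E1 := cw _ (ac q) _ x0 (u *m pr1) (v *m pr1) (t *m pr1).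
have E2 := ext_deriv_dcov u v t oD (@smooth_tautological q) Dz.
apply: etrans (congr2 +%R (congr2 (fun a b => a - b) (E u v t) (E v u t)) (E t u v)) _.
move: E1 E2; rewrite /ext_deriv.
have H (a b c d e f : R) : a - b + c = 0 -> d - e + f = 0 -> a + d - (b + e) + (c + f) = 0.
  by lra.
exact: H.
Qed.

End LocalBundle.

(** * Changes of bundle chart *)

Section BundleTransitions.
Context {R : realType} (M : manifold R) (k : nat) (w : 'I_k -> two_form M) (r : nat).
Variables (fr : local_frames w r) (W : gluing_weights (frame_dom fr)).
Local Notation n := (dim M).
Local Notation cM q := (chart_at (q : M) : chart R M n).
Local Notation U := (frame_dom fr).
Local Notation A := (fchange fr).
Implicit Types z : 'rV[R]_(n + r).

Let ac q : atlas M (cM q). Proof. exact: chart_at_atlas. Qed.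
Let Udom q p : U q p -> chart_dom (cM q) p. Proof. exact: frame_dom_sub. Qed.
Let oU q q' : open (U q `&` U q'). Proof. by apply: openI; exact: frame_dom_open. Qed.

(** Fibre coordinates are the values of a functional on a frame, so those for q' arise from those
    for q by the matrix writing the frame of q' in that of q; row vectors account for the
    transpose. *)
Definition btrans (q q' : M) (z : 'rV[R]_(n + r)) : 'rV[R]_(n + r) :=
  row_mx (transition (cM q) (cM q') (z *m pr1)) (z *m pr2 *m (A q' q (base q z))^T).

Lemma btrans_pr1 q q' z : btrans q q' z *m pr1 = transition (cM q) (cM q') (z *m pr1).
Proof. exact: row_mx_pr1. Qed.

Lemma btrans_pr2 q q' z : btrans q q' z *m pr2 = z *m pr2 *m (A q' q (base q z))^T.
Proof. exact: row_mx_pr2. Qed.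

Lemma bdom_overlap q q' z : bdom q (U q') z -> overlap (cM q) (cM q') (z *m pr1).
Proof. by move=> [cz qz]; split => //; exact: Udom. Qed.

Lemma bdomW q (X Y : set M) z : bdom q X z -> Y (base q z) -> bdom q Y z.
Proof. by move=> [cz _] Yz; split. Qed.

Lemma base_btrans q q' z : bdom q (U q') z -> base q' (btrans q q' z) = base q z.
Proof. by move=> Dz; rewrite /base btrans_pr1 transition_inv //; exact: bdom_overlap. Qed.

Lemma btrans_dom q q' z (X : set M) : bdom q (U q') z -> X (base q z) ->
  bdom q' X (btrans q q' z).
Proof.
move=> Dz Xz; split; last by rewrite /preimage /= base_btrans.
by rewrite /= btrans_pr1; exact/transition_cod/bdom_overlap.
Qed.

Lemma btrans_id q z : bdom q (U q) z -> btrans q q z = z.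
Proof.
move=> [cz qz]; apply: pr_ext; rewrite ?btrans_pr1 ?btrans_pr2.
  by rewrite /transition /= chart_invK.
by rewrite fchange_id // trmx1 mulmx1.
Qed.

Lemma btrans_comp q q' q'' z : bdom q (U q `&` U q') z -> U q'' (base q z) ->
  btrans q' q'' (btrans q q' z) = btrans q q'' z.
Proof.
move=> Dz q''z; have [cz [qz q'z]] := Dz.
have Dz' : bdom q (U q') z by exact: bdomW Dz q'z.
apply: pr_ext.
  rewrite !btrans_pr1 /transition /= chart_mapK //.
  by have [] := bdom_overlap Dz'.
by rewrite !btrans_pr2 base_btrans // -mulmxA -trmx_mul -fchange_comp.
Qed.

Lemma smooth_btrans q q' : smooth_on (bdom q (U q `&` U q')) (btrans q q').
Proof.
have oD := @open_bdom _ _ r q _ (@oU q q').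
apply: smooth_on_row_mx => //.
  apply: smooth_on_base; first exact: oU.
  apply: smooth_onW (smooth_transition (ac q) (ac q')).
  by move=> x [cx [_ q'x]]; split => //; exact: Udom.
apply: smooth_on_mulmx => //; first exact: smooth_on_cst_mulmxr.
apply: smooth_on_trmx => //.
have sA : smooth_on (chart_cod (cM q) `&` chart_inv (cM q) @^-1` (U q `&` U q'))
    (A q' q \o chart_inv (cM q)).
  by rewrite [U q `&` U q']setIC; exact: smooth_fchange.
exact: (smooth_on_base r (@oU q q') sA).
Qed.

Lemma jac_btrans_pr1 q q' z : bdom q (U q `&` U q') z ->
  jac (btrans q q') z *m pr1 = pr1 *m trjac (cM q) (cM q') (base q z).
Proof.
move=> Dz; have [cz [qz q'z]] := Dz.
have Dz' : bdom q (U q') z by exact: bdomW Dz q'z.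
have dh := smooth_on_differentiable (@smooth_btrans q q') Dz.
have dp (y : 'rV[R]_(n + r)) : differentiable (fun z : 'rV[R]_(n + r) => z *m pr1 : 'rV[R]_n) y.
  exact: (smooth_on_differentiable (smooth_on_cst_mulmxr pr1 openT)).
have dt : differentiable (transition (cM q) (cM q')) (z *m pr1).
  exact: differentiable_transition (bdom_overlap Dz').
have E1 := jac_comp dh (dp _).
have E2 := jac_comp (dp z) dt.
rewrite !jac_mulmxr in E1 E2; rewrite /trjac /base chart_invK // -E2 -E1.
by congr (jac _ _); apply/funext => y; exact: btrans_pr1.
Qed.

(** Coordinate independence of theta: [conn_change] moves Q and matches the change of the fibre
    coordinates, while [jac_btrans_pr1] turns the base Jacobian into that of [btrans]. *)
Lemma tautological_btrans q q' z : bdom q (U q `&` U q') z ->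
  tautological W q z = tautological W q' (btrans q q' z) *m (jac (btrans q q') z)^T.
Proof.
move=> Dz; have [cz [qz q'z]] := Dz.
have Dz' : bdom q (U q') z by exact: bdomW Dz q'z.
rewrite /tautological btrans_pr2 base_btrans //.
transitivity (z *m pr2 *m ((pr1 : 'M[R]_(n + r, n)) *m conn W q (base q z))^T).
  by rewrite trmx_mul mulmxA.
rewrite (conn_change W qz q'z).
move: (jac_btrans_pr1 Dz).
move: (jac _ _) (trjac _ _ _) (conn _ _ _) (A _ _ _) => J T C G JT.
have -> : (pr1 : 'M[R]_(n + r, n)) *m (T *m C *m G) = J *m pr1 *m C *m G.
  by rewrite JT !mulmxA.
by rewrite !trmx_mul !mulmxA.
Qed.

(** The pullback of omega_j changes through the base Jacobian alone, and d theta through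
    [dcov_pullback], which avoids computing any derivative of [conn] or [fchange]. *)
Lemma big_gram_btrans j q q' z : bdom q (U q `&` U q') z ->
  big_gram W j q z =
  jac (btrans q q') z *m big_gram W j q' (btrans q q' z) *m (jac (btrans q q') z)^T.
Proof.
move=> Dz; have [cz [qz q'z]] := Dz.
have Dz' : bdom q (U q') z by exact: bdomW Dz q'z.
rewrite /big_gram mulmxDr mulmxDl; congr (_ + _).
  have := local_form_change (w j) (ac q) (ac q') (Udom qz) (Udom q'z).
  rewrite -(transition_map (cM q') (Udom qz)) chart_invK //.
  rewrite /pulled_gram btrans_pr1; move: (jac_btrans_pr1 Dz).
  move: (jac _ _) (trjac _ _ _) (local_form _ (cM q') _) => J T B JT ->.
  have -> : J *m (pr1 *m B *m pr1^T) *m J^T = (J *m pr1) *m B *m (J *m pr1)^T.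
    by rewrite trmx_mul !mulmxA.
  by rewrite JT trmx_mul !mulmxA.
apply: (@dcov_pullback _ _ (bdom q (U q `&` U q')) (bdom q' (U q'))) => //.
- exact: open_bdom.
- by apply: open_bdom; exact: frame_dom_open.
- exact: smooth_btrans.
- exact: smooth_tautological.
- by move=> y Dy; apply: btrans_dom; case: Dy => cy [qy q'y].
- exact: tautological_btrans.
Qed.

Lemma jac_btrans_unit q q' z : bdom q (U q `&` U q') z -> jac (btrans q q') z \in unitmx.
Proof.
move=> Dz; have [cz [qz q'z]] := Dz.
have Dz' : bdom q (U q') z by exact: bdomW Dz q'z.
have Dz'' : bdom q' (U q' `&` U q) (btrans q q' z) by apply: btrans_dom.
have dh := smooth_on_differentiable (@smooth_btrans q q') Dz.
have dh' := smooth_on_differentiable (@smooth_btrans q' q) Dz''.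
suff /mulmx1_unit[] : jac (btrans q q') z *m jac (btrans q' q) (btrans q q' z) = 1%:M by [].
rewrite -(jac_comp dh dh') -(jac_id z).
apply/esym/near_eq_jac; last exact: (smooth_on_differentiable (@smooth_on_id _ _ setT)).
have oD := @open_bdom _ _ r q _ (@oU q q').
have : nbhs z (bdom q (U q `&` U q')) by exact: open_nbhs_nbhs.
apply: filterS => y Dy; have [cy [qy q'y]] := Dy.
by rewrite /= btrans_comp // btrans_id //; exact: bdomW Dy qy.
Qed.

(** By [gram_sum_unitP] this is triviality of the common kernel, put in a form that is visibly
    open. *)
Definition bundle_nondeg (q : M) (z : 'rV[R]_(n + r)) : Prop :=
  gram_sum (fun j => big_gram W j q z) \in unitmx.

Lemma bundle_nondeg_btrans q q' z : bdom q (U q `&` U q') z ->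
  bundle_nondeg q z -> bundle_nondeg q' (btrans q q' z).
Proof.
move=> Dz /gram_sum_unitP H; apply/gram_sum_unitP => u Hu.
have JU := jac_btrans_unit Dz.
set J := jac _ _ in JU.
suff : u *m invmx J = 0 by move=> /(congr1 (mulmx^~ J)); rewrite mulmxKV // mul0mx.
apply: H => j; rewrite (big_gram_btrans j Dz) !mulmxA mulmxKV //.
by rewrite Hu mul0mx.
Qed.

Lemma open_bundle_nondeg q : open (bdom q (U q) `&` [set z | bundle_nondeg q z]).
Proof.
have oD := @open_bdom _ _ r q _ (frame_dom_open fr q).
have -> : [set z | bundle_nondeg q z] =
  (fun z => gram_sum (fun j => big_gram W j q z)) @^-1` [set B | B \in unitmx] by [].
apply: (open_preimage_in (f := fun z => gram_sum (fun j => big_gram W j q z)) oD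
  (@open_unitmx R (n + r))).
move=> z; apply: smooth_on_continuous.
apply: smooth_on_sum => // j _.
have sB := smooth_big_gram W j q.
by apply: smooth_on_mulmx => //; exact: smooth_on_trmx.
Qed.

End BundleTransitions.

(** * Linear algebra along the zero section *)

Section ZeroSection.
Context {R : realType} (M : manifold R) (k : nat) (w : 'I_k -> two_form M) (r : nat).
Variables (fr : local_frames w r) (W : gluing_weights (frame_dom fr)).
Local Notation n := (dim M).
Local Notation cM q := (chart_at (q : M) : chart R M n).
Local Notation U := (frame_dom fr).

Let Udom q p : U q p -> chart_dom (cM q) p. Proof. exact: frame_dom_sub. Qed.

Definition zero_sec (q p : M) : 'rV[R]_(n + r) := chart_map (cM q) p *m pr1^T.

Lemma zero_sec_pr1 q p : zero_sec q p *m pr1 = chart_map (cM q) p.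
Proof. by rewrite /zero_sec -mulmxA pr1K mulmx1. Qed.

Lemma zero_sec_pr2 q p : zero_sec q p *m pr2 = 0.
Proof. by rewrite /zero_sec -mulmxA pr1_pr2 mulmx0. Qed.

Lemma base_zero_sec q p : U q p -> base q (zero_sec q p) = p.
Proof. by move=> qp; rewrite /base zero_sec_pr1 chart_mapK //; exact: Udom. Qed.

Lemma zero_sec_dom q p (X : set M) : U q p -> X p -> bdom q X (zero_sec q p).
Proof.
move=> qp Xp; split; last by rewrite /preimage /= base_zero_sec.
by rewrite /= zero_sec_pr1; exact/chart_mapS/Udom.
Qed.

(** theta is a product whose first factor, the fibre coordinate, is zero here; the product rule
    keeps only the derivative of that factor, and the derivatives of [conn] drop out. *)
Lemma jac_tautological_zero q p : U q p ->
  jac (tautological W q) (zero_sec q p) = pr2 *m (conn W q p)^T *m pr1^T.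
Proof.
move=> qp; have Dz : bdom q (U q) (zero_sec q p) by exact: zero_sec_dom.
pose G (z : 'rV[R]_(n + r)) : 'M[R]_(r, n + r) := (conn W q (base q z))^T *m pr1^T.
have oD := @open_bdom _ _ r q _ (frame_dom_open fr q).
have sG : smooth_on (bdom q (U q)) G.
  apply: smooth_on_mulmx => //; last exact: smooth_on_cst.
  apply: smooth_on_trmx => //.
  exact: (smooth_on_base r (frame_dom_open fr q) (smooth_conn W q)).
have dG := smooth_on_differentiable sG Dz.
have d2 : differentiable (fun z : 'rV[R]_(n + r) => z *m pr2 : 'rV[R]_r) (zero_sec q p).
  exact: (smooth_on_differentiable (smooth_on_cst_mulmxr pr2 openT)).
have dt := smooth_on_differentiable (smooth_tautological W q) Dz.
apply: mulmx_row_ext => v; apply: etrans (mul_jac v dt) _.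
have -> : tautological W q = fun z => (z *m pr2) *m G z.
  by apply/funext => z; rewrite /tautological /G mulmxA.
apply: etrans (derive_mulmx v d2 dG) _.
rewrite zero_sec_pr2 mul0mx addr0 derive_mulmxr // derive_id /G base_zero_sec //.
by rewrite !mulmxA.
Qed.

(** In blocks, with B the form on M and C the matrix [conn], the rows are (B, -C) and (C^T, 0). *)
Lemma big_gram_zero j q p : U q p ->
  big_gram W j q (zero_sec q p) =
  pr1 *m local_form (w j) (cM q) (chart_map (cM q) p) *m pr1^T
  + (pr2 *m (conn W q p)^T *m pr1^T - pr1 *m conn W q p *m pr2^T).
Proof.
move=> qp; rewrite /big_gram /pulled_gram zero_sec_pr1 /dcov jac_tautological_zero //.
congr (_ + (_ - _)); move: (conn _ _ _) => C.
by rewrite !trmx_mul !trmxK mulmxA.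
Qed.

Lemma big_gram_zero_pr1 j q p m (u : 'M[R]_(m, n + r)) : U q p ->
  u *m big_gram W j q (zero_sec q p) *m pr1 =
  u *m pr1 *m local_form (w j) (cM q) (chart_map (cM q) p) + u *m pr2 *m (conn W q p)^T.
Proof.
move=> /(@big_gram_zero j) ->; move: (local_form _ _ _) (conn _ _ _) => B C.
rewrite mulmxDr mulmxBr mulmxDl mulmxBl !mulmxA -!(mulmxA _ _ pr1) pr1K pr2_pr1.
by rewrite !mulmx1 !mulmx0 subr0.
Qed.

Lemma big_gram_zero_pr2 j q p m (u : 'M[R]_(m, n + r)) : U q p ->
  u *m big_gram W j q (zero_sec q p) *m pr2 = - (u *m pr1 *m conn W q p).
Proof.
move=> /(@big_gram_zero j) ->; move: (local_form _ _ _) (conn _ _ _) => B C.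
rewrite mulmxDr mulmxBr mulmxDl mulmxBl !mulmxA -!(mulmxA _ _ pr2) pr1_pr2 pr2K.
by rewrite !mulmx1 !mulmx0 !add0r.
Qed.

(** Multiply by F^T on the right: B F^T = 0, because the rows of F lie in the kernel of the
    antisymmetric B, while C^T F^T = (F C)^T is a positive scalar. *)
Lemma conn_kernel j q p m (u : 'M[R]_(m, n)) (y : 'M[R]_(m, r)) : U q p ->
  u *m local_form (w j) (cM q) (chart_map (cM q) p) + y *m (conn W q p)^T = 0 -> y = 0.
Proof.
move=> qp; set F := frame fr q (chart_map (cM q) p).
have FC : F *m conn W q p = (weight W p)%:M by exact: frame_conn.
have FB : local_form (w j) (cM q) (chart_map (cM q) p) *m F^T = 0.
  apply: trmx_inj; rewrite trmx_mul trmxK trmx0 tr_local_form mulmxN.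
  by rewrite frame_in_ker // oppr0.
move: (local_form _ _ _) (conn _ _ _) FB FC => B C FB FC.
move=> /(congr1 (mulmx^~ F^T)); rewrite mul0mx mulmxDl -!mulmxA FB mulmx0 add0r.
rewrite -trmx_mul FC tr_scalar_mx mul_mx_scalar => /eqP.
by rewrite scaler_eq0 gt_eqF ?weight_gt0 //= => /eqP.
Qed.

Hypothesis k_gt0 : (0 < k)%N.

(** The first block of the kernel equation and [conn_kernel] remove the fibre part of u. What is
    left lies in V, so its base part is u L F, and the second block gives a positive multiple of u L
    equal to 0. *)
Lemma bundle_nondeg_zero q p : U q p -> bundle_nondeg W q (zero_sec q p).
Proof.
move=> qp; apply/gram_sum_unitP => u Hu.
have u2 : u *m pr2 = 0.
  apply: (@conn_kernel (Ordinal k_gt0) q p _ (u *m pr1)) => //.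
  by rewrite -big_gram_zero_pr1 // Hu mul0mx.
have uw j : u *m pr1 *m local_form (w j) (cM q) (chart_map (cM q) p) = 0.
  have := big_gram_zero_pr1 j u qp.
  by rewrite Hu mul0mx u2 mul0mx addr0 => <-.
have uE := frame_span qp uw.
set F := frame fr q _ in uE.
have FC : F *m conn W q p = (weight W p)%:M by exact: frame_conn.
have u1 : u *m pr1 = 0.
  have /eqP := big_gram_zero_pr2 (Ordinal k_gt0) u qp.
  rewrite Hu mul0mx eq_sym oppr_eq0 uE -mulmxA FC mul_mx_scalar.
  rewrite scaler_eq0 gt_eqF ?weight_gt0 //= => /eqP u10.
  by rewrite uE u10 !mul0mx.
by apply: (@pr_ext _ n r); rewrite ?u1 ?u2 mul0mx.
Qed.
End ZeroSection.

(** * The nondegenerate part of the dual bundle as a manifold *)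

Section BundleManifold.
Context {R : realType} (M : manifold R) (k : nat) (w : 'I_k -> two_form M) (r : nat).
Variables (fr : local_frames w r) (W : gluing_weights (frame_dom fr)).
Hypothesis k_gt0 : (0 < k)%N.
Local Notation n := (dim M).
Local Notation cM q := (chart_at (q : M) : chart R M n).
Local Notation U := (frame_dom fr).
Local Notation A := (fchange fr).
Implicit Types (e : M * 'rV[R]_r) (z : 'rV[R]_(n + r)).

Let Udom q p : U q p -> chart_dom (cM q) p. Proof. exact: frame_dom_sub. Qed.

(* [(p, eta)] stands for the functional on the characteristic space at [p]
   whose values on the frame [frame fr p] are the entries of [eta]. *)
Definition bcoord (q : M) e : 'rV[R]_(n + r) :=
  row_mx (chart_map (cM q) e.1) (e.2 *m (A q e.1 e.1)^T).

Definition bpoint (q : M) z : M * 'rV[R]_r :=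
  (base q z, z *m pr2 *m (A (base q z) q (base q z))^T).

Lemma base_bcoord q e : U q e.1 -> base q (bcoord q e) = e.1.
Proof. by move=> qe; rewrite /base /bcoord row_mx_pr1 chart_mapK //; exact: Udom. Qed.

Lemma bcoord_dom q e (X : set M) : U q e.1 -> X e.1 -> bdom q X (bcoord q e).
Proof.
move=> qe Xe; split; last by rewrite /preimage /= base_bcoord.
by rewrite /= row_mx_pr1; exact/chart_mapS/Udom.
Qed.

Lemma bcoordK q e : U q e.1 -> bpoint q (bcoord q e) = e.
Proof.
move=> qe; rewrite /bpoint base_bcoord // row_mx_pr2 -mulmxA -trmx_mul -fchange_comp //;
  try exact: frame_dom_center.
by rewrite fchange_id ?trmx1 ?mulmx1 -?surjective_pairing //; exact: frame_dom_center.
Qed.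

Lemma bpointK q q' z : bdom q (U q `&` U q') z -> bcoord q' (bpoint q z) = btrans fr q q' z.
Proof.
move=> [cz [qz q'z]]; apply: pr_ext; rewrite ?row_mx_pr1 ?row_mx_pr2 //=.
by rewrite -mulmxA -trmx_mul -fchange_comp //; exact: frame_dom_center.
Qed.

Lemma btrans_bcoord q q' e : U q e.1 -> U q' e.1 ->
  btrans fr q q' (bcoord q e) = bcoord q' e.
Proof.
by move=> qe q'e; rewrite -bpointK ?bcoordK //; apply: bcoord_dom.
Qed.

Lemma bcoord_zero q p : bcoord q (p, 0) = zero_sec r q p.
Proof. by rewrite /bcoord mul0mx row_mxE0. Qed.

Definition bregular e : Prop := bundle_nondeg W e.1 (bcoord e.1 e).

Lemma bregular_zero p : bregular (p, 0).
Proof.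
by rewrite /bregular bcoord_zero; apply: bundle_nondeg_zero => //; exact: frame_dom_center.
Qed.

Lemma bregularP q e : U q e.1 -> bregular e <-> bundle_nondeg W q (bcoord q e).
Proof.
move=> qe; have ce := frame_dom_center fr e.1; split => H.
  by rewrite -(btrans_bcoord ce qe); apply: bundle_nondeg_btrans => //; exact: bcoord_dom.
rewrite /bregular -(btrans_bcoord qe ce); apply: bundle_nondeg_btrans => //.
exact: bcoord_dom.
Qed.

(** The fibre over p is identified with R^r by the frame centred at p itself, so no quotient is
    formed. These frames need not vary continuously with p, and the topology comes from the charts
    instead of the product. *)
Definition bspace : Type := {e | bregular e}.

Definition bzero (p : M) : bspace := exist _ (p, 0) (bregular_zero p).

Definition bdomain (q : M) : set bspace := [set e | U q (sval e).1].

Definition bcod (q : M) : set 'rV[R]_(n + r) :=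
  bdom q (U q) `&` [set z | bundle_nondeg W q z].

Definition bmap (q : M) (e : bspace) : 'rV[R]_(n + r) := bcoord q (sval e).

(** Charts need a total inverse; where [bpoint q z] is not regular, the value is the zero vector
    over q, which is regular. *)
Definition binv (q : M) (z : 'rV[R]_(n + r)) : bspace :=
  match pselect (bregular (bpoint q z)) with
  | left H => exist _ (bpoint q z) H
  | right _ => bzero q
  end.

Lemma binvE q z : bcod q z -> sval (binv q z) = bpoint q z.
Proof.
move=> [[cz qz] nz]; rewrite /binv; case: pselect => //= -[].
by apply/(bregularP (q := q)) => //; rewrite bpointK ?btrans_id.
Qed.

Lemma bspace_inj (e e' : bspace) : sval e = sval e' -> e = e'.
Proof.
move: e e' => [e He] [e' He'] /= E; subst e'; congr exist; exact: Prop_irrelevance.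
Qed.

Lemma bcod_preimage q (X : set M) :
  bcod q `&` binv q @^-1` [set e | X (sval e).1] = bcod q `&` bdom q X.
Proof.
apply/seteqP; split => z [cz]; rewrite /preimage /= ?binvE //.
  by move=> Xz; split => //; split => //; case: cz => -[].
by move=> [_ Xz]; split => //; rewrite binvE.
Qed.

Lemma open_bcod_preimage q (X : set M) : open X ->
  open (bcod q `&` binv q @^-1` [set e | X (sval e).1]).
Proof.
move=> oX; rewrite bcod_preimage; apply: openI; first exact: open_bundle_nondeg.
exact: open_bdom.
Qed.

Lemma bmapS q (e : bspace) : bdomain q e -> bcod q (bmap q e).
Proof.
move=> qe; split; first exact: (bcoord_dom qe qe).
have [H _] := bregularP qe; exact: H (proj2_sig e).
Qed.

Lemma binvS q z : bcod q z -> bdomain q (binv q z).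
Proof. by move=> cz; rewrite /bdomain /= binvE //; case: cz => -[]. Qed.

Lemma bmapK q (e : bspace) : bdomain q e -> binv q (bmap q e) = e.
Proof.
by move=> qe; apply: bspace_inj; rewrite binvE ?bcoordK //; exact: bmapS.
Qed.

Lemma binvK q z : bcod q z -> bmap q (binv q z) = z.
Proof.
move=> cz; have [[c1 qz] _] := cz.
by rewrite /bmap binvE // bpointK ?btrans_id.
Qed.

Lemma bmap_binv q q' z : (bcod q `&` binv q @^-1` bdomain q') z ->
  bmap q' (binv q z) = btrans fr q q' z.
Proof.
rewrite bcod_preimage => -[cz [_ q'z]]; have [[c1 qz] _] := cz.
by rewrite /bmap binvE // bpointK.
Qed.

Lemma smooth_bmap_binv q q' :
  smooth_on (bcod q `&` binv q @^-1` bdomain q') (bmap q' \o binv q).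
Proof.
have oD : open (bcod q `&` binv q @^-1` bdomain q').
  by apply: open_bcod_preimage; exact: frame_dom_open.
apply: (eq_smooth_on (f := btrans fr q q')) => //.
  by move=> z /bmap_binv.
apply: smooth_onW (@smooth_btrans _ _ _ _ _ fr q q').
by rewrite bcod_preimage => z [[[cz qz] _] [_ q'z]]; split.
Qed.

(** Points over the same base point share the chart centred there; otherwise disjoint open sets of M
    are lifted. *)
Lemma bseparated (e e' : bspace) : e <> e' ->
  (exists q, bdomain q e /\ bdomain q e') \/
  exists A B : set bspace, [/\ A e, B e', A `&` B = set0,
    forall q, open (bcod q `&` binv q @^-1` A) &
    forall q, open (bcod q `&` binv q @^-1` B)].
Proof.
move=> _; have [E|/eqP ne] := pselect ((sval e).1 = (sval e').1).
  left; exists (sval e).1; split; rewrite /bdomain /= -?E; exact: frame_dom_center.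
right; have := @hausdorff_carrier _ M; rewrite open_hausdorff => /(_ _ _ ne).
move=> [[X Y] /=]; rewrite !inE => -[Xe Ye] [oX oY XY].
exists [set e | X (sval e).1], [set e | Y (sval e).1]; split => //.
- apply/seteqP; split => x //= [Xx Yx].
  by have : (X `&` Y) (sval x).1 by []; rewrite XY.
- by move=> q; exact: open_bcod_preimage.
- by move=> q; exact: open_bcod_preimage.
Qed.

(** The centres of the weights index countably many charts that suffice: a weight positive at p
    forces p into the frame domain of its centre. *)
Lemma bcover (e : bspace) : exists i, bdomain (gw_center W i) e.
Proof.
have [i ip] := gw_pos W (sval e).1; exists i.
by apply: (gw_dom (w := w)); rewrite gt_eqF.
Qed.

Definition bglue : glue_data (n + r) :=
  @GlueData R (n + r) bspace M bdomain bcod bmap binv (@open_bundle_nondeg _ _ _ _ _ fr W)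
    bmapS binvS bmapK binvK (fun e : bspace => (sval e).1)
    (fun e : bspace => frame_dom_center fr (sval e).1)
    (fun q q' => @open_bcod_preimage q (U q') (frame_dom_open fr q'))
    smooth_bmap_binv (gw_center W) bcover bseparated.

Definition bmanifold : manifold R := glued_manifold bglue.

End BundleManifold.

(** * The coisotropic embedding *)

Section BundleForms.
Context {R : realType} (M : manifold R) (k : nat) (w : 'I_k -> two_form M) (r : nat).
Variables (fr : local_frames w r) (W : gluing_weights (frame_dom fr)).
Hypothesis k_gt0 : (0 < k)%N.
Local Notation n := (dim M).
Local Notation cM q := (chart_at (q : M) : chart R M n).
Local Notation U := (frame_dom fr).
Local Notation N := (bmanifold W k_gt0).
Local Notation space := (bspace W).
Local Notation inv := (binv W k_gt0).

Let Udom q p : U q p -> chart_dom (cM q) p. Proof. exact: frame_dom_sub. Qed.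

Definition bgram (j : 'I_k) (e : N) : 'M[R]_(dim N) :=
  big_gram W j (sval (e : space)).1 (bmap (sval (e : space)).1 e).

(** The preferred chart at a point of N is the one centred at its base point q', so the Jacobian
    inside [local_form] is that of [btrans], and [big_gram_btrans] brings the Gram matrix back to
    the chart of q. *)
Lemma local_form_bgram j q z : bcod W q z ->
  local_form (bgram j) (glued_chart (q : gindex (bglue W k_gt0))) z = big_gram W j q z.
Proof.
move=> cz; have [[c1 qz] _] := cz.
have E1 : (sval (inv q z)).1 = base q z by rewrite binvE.
set q' := base q z in E1 qz.
have q'q' : U q' q' by exact: frame_dom_center.
have Dz : bdom q (U q `&` U q') z by split.
have H : forall y, (bcod W q `&` inv q @^-1` bdomain q') y ->
  (bmap q' \o inv q) y = btrans fr q q' y by move=> y; exact: bmap_binv.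
have Oz : (bcod W q `&` inv q @^-1` bdomain q') z.
  by split => //; rewrite /preimage /bdomain /= E1.
have oO : open (bcod W q `&` inv q @^-1` bdomain q').
  by apply: open_bcod_preimage; exact: frame_dom_open.
have EJ : jac (bmap q' \o inv q) z = jac (btrans fr q q') z.
  apply: near_eq_jac.
    have : nbhs z (bcod W q `&` inv q @^-1` bdomain q') by exact: open_nbhs_nbhs.
    exact: filterS H.
  exact: smooth_on_differentiable (@smooth_bmap_binv _ _ _ _ _ fr W k_gt0 q q') Oz.
transitivity (jac (bmap q' \o inv q) z *m big_gram W j q' (bmap q' (inv q z)) *m
   (jac (bmap q' \o inv q) z)^T).
  by rewrite jac.unlock /local_form /= /bgram -E1.
rewrite EJ; have -> : bmap q' (inv q z) = btrans fr q q' z by exact: H.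
by rewrite -big_gram_btrans.
Qed.

Lemma bgram_alt j (e : N) : (bgram j e)^T = - bgram j e.
Proof. exact: tr_big_gram. Qed.

Lemma bgram_smooth j (c : chart R N (dim N)) : atlas N c ->
  smooth_on (chart_cod c) (local_form (bgram j) c).
Proof.
move=> [q _ <-]; apply: (eq_smooth_on (f := big_gram W j q)).
- exact: chart_cod_open.
- by move=> z cz; rewrite local_form_bgram.
- by apply: smooth_onW (smooth_big_gram W j q) => z [].
Qed.

Definition bform (j : 'I_k) : two_form N := TwoForm (bgram_alt j) (@bgram_smooth j).

Lemma bform_closed j : closed_form (w j) -> closed_form (bform j).
Proof.
move=> cw _ [q _ <-] z cz u v t.
have nE : \near z, big_gram W j q z =
    local_form (bgram j) (glued_chart (q : gindex (bglue W k_gt0))) z.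
  have : nbhs z (bcod W q).
    by apply: open_nbhs_nbhs; split => //; exact: open_bundle_nondeg.
  by apply: filterS => y cy; rewrite local_form_bgram.
apply: etrans _ (big_gram_closed W u v t cw (proj1 cz)).
have E (a b c : 'rV[R]_(n + r)) := congr1 (fun X => form X b c) (near_eq_derive a nE).
exact/esym/(congr2 +%R (congr2 (fun a b => a - b) (E u v t) (E v u t)) (E t u v)).
Qed.

(** Membership in N is this very condition, expressed in the preferred chart. *)
Lemma bform_nondeg (e : N) : char_dist bform e = 0.
Proof.
apply/bigcap_kermx_eq0P; apply/gram_sum_unitP.
exact: (proj2_sig (e : space)).
Qed.

Definition bembed (p : M) : N := bzero W k_gt0 p.

Lemma bmap_bembed q p : bmap q (bembed p : space) = zero_sec r q p.
Proof. exact: bcoord_zero. Qed.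

Lemma bembed_local (c : chart R M n) q x : chart_cod c x -> U q (chart_inv c x) ->
  bmap q (bembed (chart_inv c x) : space) = transition c (cM q) x *m pr1^T.
Proof. by move=> cx qx; rewrite bmap_bembed. Qed.

(** Openness in N is tested in charts, and near p the chart centred at p suffices; there the map
    reads as [zero_sec r p], which is continuous. *)
Lemma bembed_continuous : continuous bembed.
Proof.
move=> p A; rewrite nbhsE => -[A' [oA' A'p] A'A].
pose q : M := p.
have qp : U q p by exact: frame_dom_center.
have cp : bcod W q (zero_sec r q p).
  by split; [exact: (zero_sec_dom qp qp)|exact: bundle_nondeg_zero].
have Bp : (bcod W q `&` inv q @^-1` A') (zero_sec r q p).
  split => //; rewrite /preimage /= -bmap_bembed.
  by rewrite (bmapK k_gt0) // /bdomain.
have oB : open (bcod W q `&` inv q @^-1` A') by exact: oA'.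
have cz : {for p, continuous (fun p => zero_sec r q p)}.
  apply: (@continuous_comp _ _ _ (chart_map (cM q)) (fun x : 'rV[R]_n => x *m pr1^T)).
    by apply: chart_map_cont; exact: Udom.
  exact: (smooth_on_continuous (smooth_on_cst_mulmxr _ openT)).
have key (C : set 'rV[R]_(n + r)) : open C -> C (zero_sec r q p) ->
    nbhs p (U q `&` [set p' | C (zero_sec r q p')]).
  move=> oC Cp; apply: filterI; first by apply: open_nbhs_nbhs; split => //; exact: frame_dom_open.
  exact: (cz _ (open_nbhs_nbhs (conj oC Cp))).
have := key _ oB Bp.
apply: filterS => p' [qp' [cp' ]]; rewrite /preimage /= -bmap_bembed.
by rewrite (bmapK k_gt0) // => /A'A.
Qed.

Lemma bembed_smooth : smooth_map bembed.
Proof.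
split; first exact: bembed_continuous.
move=> c _ ac [q _ <-].
have oD : open (chart_cod c `&` chart_inv c @^-1` U q).
  by apply: open_chart_preimage; exact: frame_dom_open.
apply: (eq_smooth_on (f := fun x => transition c (cM q) x *m pr1^T)) => //.
  by move=> x [cx qx]; exact: esym (bembed_local cx qx).
apply: smooth_on_mulmx => //; last exact: smooth_on_cst.
apply: smooth_onW (smooth_transition ac (chart_at_atlas q)).
by move=> x [cx qx]; split => //; exact: Udom.
Qed.

(** In the preferred charts, both centred at p, the embedding is the linear map x |-> x pr1^T near
    the coordinates of p. *)
Lemma differential_bembed p (u : tangent p) :
  differential bembed u = u *m (pr1^T : 'M[R]_(n, n + r)).
Proof.
rewrite /differential diff_jac; congr (u *m _).
have pp : U p p by exact: frame_dom_center.
have cx : nbhs (chart_map (cM p) p) (chart_cod (cM p)).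
  by apply: open_nbhs_nbhs; split; [exact: chart_cod_open|exact/chart_mapS/Udom].
rewrite -[RHS](jac_mulmxr _ (chart_map (cM p) p)); apply/esym/near_eq_jac; last first.
  exact: (smooth_on_differentiable (smooth_on_cst_mulmxr _ openT)).
apply: filterS cx => x cx.
apply: esym; apply: etrans (bmap_bembed p _) _.
by rewrite /zero_sec chart_invK.
Qed.

Lemma bembed_embedding : embedding bembed.
Proof.
split.
- exact: bembed_smooth.
- move=> p u v /=; rewrite !differential_bembed => /(congr1 (mulmx^~ pr1)).
  by rewrite -!mulmxA pr1K !mulmx1.
- by move=> p p' /(congr1 (fun e : space => (sval e).1)).
(* The witness is all of N lying over X; it meets the zero section exactly in the image of X. *)
- move=> X oX; exists [set e : space | X (sval e).1] => //.
  by move=> q; exact: open_bcod_preimage.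
Qed.

Lemma bgram_bembed j p : bgram j (bembed p) = big_gram W j p (zero_sec r p p).
Proof. by rewrite /bgram bmap_bembed. Qed.

Lemma bembed_pullback j p (u v : tangent p) :
  form_at (bform j) (differential bembed u) (differential bembed v) = form_at (w j) u v.
Proof.
have pp : U p p by exact: frame_dom_center.
rewrite !differential_bembed /form_at /form /= bgram_bembed.
rewrite trmx_mul trmxK mulmxA big_gram_zero_pr1 // local_form_center.
by rewrite mulmx_pr1K mulmx_pr1_pr2 mul0mx addr0.
Qed.

Lemma bembed_coisotropic : coisotropic k bform bembed.
Proof.
move=> p X H; have pp : U p p by exact: frame_dom_center.
pose j0 := Ordinal k_gt0.
(* Orthogonality to the basis vectors of TM, entry by entry, is the equation that [conn_kernel]
   solves. *)
have E : X *m pr1 *m local_form (w j0) (cM p) (chart_map (cM p) p)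
    + X *m pr2 *m (conn W p p)^T = 0.
  rewrite -big_gram_zero_pr1 //; apply/rowP => i.
  have := H j0 (ltn_ord j0) (delta_mx 0 i); rewrite differential_bembed /form_at /form.
  rewrite /= bgram_bembed trmx_mul trmxK mulmxA trmx_delta -colE => /=.
  by rewrite !mxE.
have X2 : X *m pr2 = 0 by exact: conn_kernel E.
exists (X *m pr1); rewrite differential_bembed; apply: pr_ext.
  by rewrite mulmx_pr1K.
by rewrite X2 mulmx_pr1_pr2.
Qed.

End BundleForms.

Theorem theorem7p12 (R : realType) (k : nat) (M : manifold R)
    (omega : 'I_k -> two_form M) (hk : (0 < k)%N)
    (homega : presymplectic omega) :
  exists (N : manifold R) (omega' : 'I_k -> two_form N) (f : M -> N),
    [/\ symplectic omega',
        embedding f,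
        forall (j : 'I_k) (p : M) (u v : tangent p),
          form_at (omega' j) (differential f u) (differential f v)
          = form_at (omega j) u v &
        coisotropic k omega' f].
Proof.
have [closed_omega _ [r rank_r]] := homega.
have [fr] := local_frames_exist rank_r.
(* The sequence of centres of the weights requires a point. If M is empty, M itself with the
   identity serves as N, every pointwise claim being vacuous. *)
have [[p0]|noM] := pselect (inhabited M); last first.
  have nM (p : M) : False by apply: noM.
  exists M, omega, id; split.
  - by split => // p; case: (nM p).
  - split.
    + split=> [p|c d ac ad]; first by case: (nM p).
      by apply: smooth_on_local => x _; case: (nM (chart_inv c x)).
    + by move=> p; case: (nM p).
    + by [].
    + by move=> X oX; exists X.
  - by move=> j p; case: (nM p).
  - by move=> p; case: (nM p).
have [W] := gluing_weights_exist p0 (frame_dom_open fr) (frame_dom_center fr)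
  (@frame_dom_sub _ _ _ _ _ fr).
exists (bmanifold W hk), (bform W hk), (bembed W hk); split.
- split=> [j|p]; [exact: bform_closed|exact: bform_nondeg].
- exact: bembed_embedding.
- exact: bembed_pullback.
- exact: bembed_coisotropic.
Qed.
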